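(* Let $p\in(0,1)$ and let $f:\mathbb{R}\to[0,\infty)$ be a non-negative measurable $2\pi$-periodic function with $0<\int_0^{2\pi}f<\infty$. Then the differential equation $$h^{1-p}(h''+h)=2f$$ has a non-negative $2\pi$-periodic weak solution $h:\mathbb{R}\to[0,\infty)$.
   Context: The equation is the planar $L_p$-Minkowski problem written for the support function. Weak solution: $h$ is a non-negative continuous $2\pi$-periodic function, which is the restriction to the unit circle of the support function of a planar convex body $K$ containing the origin (i.e. $h(\theta)=\max_{x\in K}\langle x,(\cos\theta,\sin\theta)\rangle$); for such $h$ the distribution $h''+h$ is a non-negative measure (the surface area measure $S_K$ of $K$, $S_K(\omega)$ being the length of the part of $\partial K$ with exterior unit normal in $\omega$), and the equation holds in the sense of measures on the circle $\mathbb{R}/2\pi\mathbb{Z}$: the measure with density $h^{1-p}$ with respect to $h''+h$ equals the measure $2f(\theta)\,d\theta$. *)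

(* Defs.v *)
From HB Require Import structures.
From mathcomp Require Import all_boot all_order all_algebra.
From mathcomp Require Import all_classical all_reals all_analysis.

Set Implicit Arguments.
Unset Strict Implicit.
Unset Printing Implicit Defensive.

Import Order.TTheory GRing.Theory Num.Theory.
Import numFieldNormedType.Exports.

Local Open Scope classical_set_scope.
Local Open Scope ring_scope.

(* The real line with the sigma-algebra of Lebesgue measurable sets, i.e. the
   domain of completed_lebesgue_measure; R itself carries the Borel sets. *)
Definition lebesgue_line (R : realType) : measurableType _ :=
  caratheodory_type ((wlength (R := R) idfun)^*)%mu.

Definition lebesgue_measurable_fun (R : realType) (f : R -> R) : Prop :=
  measurable_fun [set: lebesgue_line R] (f : lebesgue_line R -> R).

Definition convex_body (R : realType) (K : set (R * R)) : Prop :=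
  [/\ compact K, convex_set K & K° !=set0].

Definition is_support_function (R : realType) (K : set (R * R))
    (h : R -> R) : Prop :=
  forall t, (exists2 x, K x & x.1 * cos t + x.2 * sin t = h t) /\
    (forall x, K x -> x.1 * cos t + x.2 * sin t <= h t).

Definition smooth (R : realType) (phi : R -> R) : Prop :=
  forall (n : nat) (x : R), derivable (derive1n n phi) x 1.

(* A measure on the circle R/2piZ is encoded as a Borel measure on R carried
   by the fundamental domain [0, 2pi[; a test function on the circle is a
   smooth 2pi-periodic function on R. The condition says that the distribution
   h'' + h on the circle is the measure mu. *)
Definition distr_d2D (R : realType) (h : R -> R)
    (mu : {finite_measure set (measurableTypeR R) -> \bar R}) : Prop :=
  mu (~` `[0, pi *+ 2[) = 0%E /\
  forall phi : R -> R, smooth phi -> periodic phi (pi *+ 2) ->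
    \int[lebesgue_measure]_(t in `[0, pi *+ 2])
        (h t * (derive1n 2 phi t + phi t)) =
    \int[mu]_(t in `[0, pi *+ 2[) phi t.

(* Since 1 - p != 0, the power 0 `^ (1 - p) is 0. *)
Definition weak_solution (R : realType) (p : R) (f h : R -> R) : Prop :=
  [/\ forall t, 0 <= h t,
      continuous h,
      periodic h (pi *+ 2),
      exists K : set (R * R),
        [/\ convex_body K, K (0, 0) & is_support_function K h]
    & exists2 mu : {finite_measure set (measurableTypeR R) -> \bar R},
        distr_d2D h mu &
        forall A : set (measurableTypeR R),
          measurable A -> A `<=` `[0, pi *+ 2[ ->
          (\int[mu]_(t in A) ((h t) `^ (1 - p))%:E =
           \int[completed_lebesgue_measure]_(t in A) (2 * f t)%:E)%E ].

(* Main.v *)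
(* Discretize the circle by the multiples of [d = pi / m]. In terms of the
   support numbers [h i] of a polygon with these normal angles, the edge lengths
   are [l i = (h (i + 1) + h (i - 1) - 2 cos d h i) / d] up to a constant
   factor, and the discrete problem is [l i * h i ^ (1 - p) = alpha i] with
   [alpha i] the mass of [2 f] between two grid points. Its solutions are the
   critical points, modulo translations, of
   [1/2 \sum_i h i * l i + (1 / q) \sum_i alpha i ^ (1 + q) * l i ^ (- q)] with
   [q = p / (1 - p)], which is coercive: the second term keeps the edges
   nondegenerate, so that a minimizer exists without any minimax over the
   position of the origin, and the Lagrange multiplier of the closing condition
   is the translation which makes [h] positive.
   Since [f] does not concentrate on two antipodal directions, the concavity of
   [t ^ p] bounds the polygons uniformly in [m]. Limits are taken along an
   ultrafilter, which avoids extracting subsequences: the support numbers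
   converge uniformly, the edge measures converge weakly (through their quantile
   functions), and the limit body cannot be a segment, for then the edge measure,
   and hence [f], would be carried by two antipodal directions. *)
Require Import Defs.
From HB Require Import structures.
From mathcomp Require Import all_boot all_order all_algebra.
From mathcomp Require Import all_classical all_reals all_analysis.
From mathcomp Require Import measurable_realfun.
From mathcomp Require Import ring lra zify.
Import Order.TTheory GRing.Theory Num.Theory.
Import numFieldNormedType.Exports.
Local Open Scope classical_set_scope.
Local Open Scope ring_scope.

Set Implicit Arguments.
Unset Strict Implicit.
Unset Printing Implicit Defensive.

(** * Discrete second differences on the circle *)

(** The exponent of the barrier is dictated by the Euler-Lagrange equation. At a critical point [h]
    differs by a translation from [alpha i ^ (1 + q) * l i ^ (- q - 1)], and since
    [1 + q = 1 / (1 - p)] this is [(alpha i / l i) ^ (1 / (1 - p))]: an expression that is visibly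
    positive and solves the equation as soon as its edges are the [l i]. No position of the origin
    has to be found. Two quantities are uniform in [m]: the energy of a competitor, which depends
    only on the total mass of the weights, and the determinant of their second moment matrix, which
    tends to that of [2 f] and is positive because [f] is a density. The first bounds the area, and
    both together bound the vertices. In the limit the origin may reach the boundary, where [h]
    vanishes. Hence the equation is never divided by [h]; it passes to the limit as a product, with
    a Hölder estimate for the power. *)

Definition int_periodic (R : Type) (N : nat) (F : int -> R) : Prop :=
  forall i, F (i + N%:Z) = F i.

Definition discrete_op (R : realType) (d : R) (h : int -> R) (i : int) : R :=
  h (i + 1) + h (i - 1) - 2 * cos d * h i.

Section DiscreteCalculus.
Variable R : realType.
Implicit Types (F G h g : int -> R) (N m : nat) (d : R).

Lemma int_periodicM (T : Type) N (F : int -> T) (k i : int) :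
  int_periodic N F -> F (i + k * N%:Z) = F i.
Proof.
move=> FN; have nn (n : nat) j : F (j + n%:Z * N%:Z) = F j.
  elim: n => [|n IHn]; first by rewrite mul0r addr0.
  by rewrite -addn1 PoszD mulrDl mul1r addrA FN IHn.
case: k => n; first exact: nn.
by rewrite -(nn n.+1) NegzE mulNr subrK.
Qed.

Lemma int_periodic_ind N (P : int -> Prop) : (0 < N)%N ->
  (forall i, P i -> P (i + N%:Z)) -> (forall i, P (i + N%:Z) -> P i) ->
  (forall i : nat, (i < N)%N -> P i%:Z) -> forall i, P i.
Proof.
move=> N0 up down base i.
have H (n : nat) j : P j <-> P (j + n%:Z * N%:Z).
  elim: n => [|n [IH1 IH2]]; first by rewrite mul0r addr0.
  rewrite -addn1 PoszD mulrDl mul1r addrA; split=> [/IH1/up//|/down/IH2//].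
have Pr : P (i %% N%:Z)%Z.
  have r0 : 0 <= (i %% N%:Z)%Z by apply: modz_ge0; lia.
  have rN : (i %% N%:Z)%Z < N%:Z by apply: ltz_pmod.
  by case: (i %% N%:Z)%Z r0 rN => // k _; rewrite ltz_nat; exact: base.
rewrite (divz_eq i N%:Z) addrC; case: (i %/ N%:Z)%Z => n; first exact: (iffLR (H n _) Pr).
by apply: (iffRL (H n.+1 _)); rewrite NegzE mulNr subrK.
Qed.

Lemma sum_shift N F k : int_periodic N F ->
  \sum_(i < N) F (i%:Z + k) = \sum_(i < N) F i%:Z.
Proof.
move=> FN; have S j : \sum_(i < N) F (i%:Z + (j + 1)) = \sum_(i < N) F (i%:Z + j).
  case: N FN => [|N] FN; first by rewrite !big_ord0.
  rewrite big_ord_recr big_ord_recl /= [LHS]addrC; congr (_ + _).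
    by rewrite -[in RHS]FN; congr F; lia.
  by apply: eq_bigr => i _; congr F; rewrite /bump /=; lia.
have nn (n : nat) j : \sum_(i < N) F (i%:Z + (j + n%:Z)) = \sum_(i < N) F (i%:Z + j).
  elim: n => [|n IHn]; first by rewrite addr0.
  by rewrite -addn1 PoszD addrA S IHn.
have E0 : \sum_(i < N) F (i%:Z + 0) = \sum_(i < N) F i%:Z.
  by apply: eq_bigr => i _; rewrite addr0.
case: k => n; first by rewrite -[n%:Z]add0r nn.
by rewrite -(nn n.+1) NegzE addNr.
Qed.

Lemma int_periodic_op N d h : int_periodic N h -> int_periodic N (discrete_op d h).
Proof.
by move=> hN i; rewrite /discrete_op (addrAC i N%:Z 1) (addrAC i N%:Z (- 1)) !hN.
Qed.

(** Summation by parts on the discrete circle: a shift by one exchanges the two neighbour terms. The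
    closing condition, the first variation and the weak limit all rest on this symmetry. *)
Lemma discrete_op_sym N d h g : int_periodic N h -> int_periodic N g ->
  \sum_(i < N) h i%:Z * discrete_op d g i%:Z
  = \sum_(i < N) g i%:Z * discrete_op d h i%:Z.
Proof.
move=> hN gN; rewrite /discrete_op.
under eq_bigr do rewrite mulrBr mulrDr.
under [RHS]eq_bigr do rewrite mulrBr mulrDr.
rewrite !sumrB !big_split /=; congr (_ - _); last by apply: eq_bigr => i _; ring.
have E (a b : int -> R) : int_periodic N a -> int_periodic N b ->
    \sum_(i < N) a i%:Z * b (i%:Z + 1) = \sum_(i < N) b i%:Z * a (i%:Z - 1).
  move=> aN bN; rewrite -(@sum_shift N (fun i => b i * a (i - 1)) 1); last first.
    by move=> i; rewrite bN addrAC aN.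
  by apply: eq_bigr => i _; rewrite addrK mulrC.
by rewrite (E h g)// (E g h)// addrC.
Qed.

Lemma discrete_opB d h g i :
  discrete_op d (fun i => h i - g i) i = discrete_op d h i - discrete_op d g i.
Proof. by rewrite /discrete_op; ring. Qed.

Lemma discrete_op_lin d h g t i :
  discrete_op d (fun i => h i + t * g i) i = discrete_op d h i + t * discrete_op d g i.
Proof. by rewrite /discrete_op; ring. Qed.

(** These are the support numbers of the point [(a, b)]. The coefficient [2 * cos d], in place of
    [2], makes the addition formulas cancel exactly, so that translating a polygon does not change
    its edges. *)
Lemma discrete_op_wave d a b (i : int) :
  discrete_op d (fun i => a * cos (i%:~R * d) + b * sin (i%:~R * d)) i = 0.
Proof.
rewrite /discrete_op intrD intrB mulrDl mulrBl !mul1r cosB cosD sinB sinD.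
by ring.
Qed.

Lemma discrete_op_const d i : discrete_op d (fun=> 1) i = 2 - 2 * cos d.
Proof. by rewrite /discrete_op; ring. Qed.

Section grid.
Variables (m : nat) (m0 : (0 < m)%N).
Let N := m.*2.
Let d : R := pi / m%:R.

Lemma step_gt0 : 0 < d.
Proof. by rewrite divr_gt0 ?pi_gt0// ltr0n. Qed.

Lemma step_ge0 : 0 <= d.
Proof. exact/ltW/step_gt0. Qed.

Lemma step_half : m%:R * d = pi.
Proof. by rewrite mulrC divfK// pnatr_eq0 -lt0n. Qed.

Lemma step_full : N%:R * d = pi *+ 2.
Proof. by rewrite /N -addnn natrD mulrDl step_half mulr2n. Qed.

Lemma cos_periodic : int_periodic N (fun i : int => cos (i%:~R * d)).
Proof. by move=> i; rewrite intrD mulrDl step_full cosD2pi. Qed.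

Lemma sin_periodic : int_periodic N (fun i : int => sin (i%:~R * d)).
Proof. by move=> i; rewrite intrD mulrDl step_full sinD2pi. Qed.

(* The Wronskian of [h] and [sin] is nondecreasing along the half period where
   [sin] is nonnegative. *)
Lemma discrete_op_ge0_half h : h 0 = 0 -> 0 <= h 1 ->
  (forall i, 0 <= discrete_op d h i) -> forall i : nat, (i <= m)%N -> 0 <= h i%:Z.
Proof.
move=> h0 h1 Lh; pose s (i : nat) := sin (i%:R * d).
have s_ge0 (i : nat) : (i <= m)%N -> 0 <= s i.
  move=> im; apply: sin_ge0_pi; rewrite mulr_ge0 ?step_ge0//=.
  by rewrite -step_half ler_wpM2r ?step_ge0// ler_nat.
have s_gt0 (i : nat) : (0 < i < m)%N -> 0 < s i.
  move=> /andP[i0 im]; apply: sin_gt0_pi; rewrite mulr_gt0 ?step_gt0 ?ltr0n//=.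
  by rewrite -step_half ltr_pM2r ?step_gt0// ltr_nat.
have ss (i : nat) : s i.+2 = 2 * cos d * s i.+1 - s i.
  have := discrete_op_wave d 0 1 i.+1.
  rewrite /discrete_op !mul0r !add0r !mul1r (_ : i.+1%:Z - 1 = i%:Z); last by lia.
  rewrite (_ : i.+1%:Z + 1 = i.+2%:Z); last by lia.
  by rewrite /s -!pmulrn => E; lra.
have hh (i : nat) : h i.+2%:Z >= 2 * cos d * h i.+1%:Z - h i%:Z.
  have := Lh i.+1%:Z; rewrite /discrete_op (_ : i.+1%:Z - 1 = i%:Z); last by lia.
  by rewrite (_ : i.+1%:Z + 1 = i.+2%:Z); [lra|lia].
(* The increment of this expression from [i] to [i.+1] is [s i.+1] times [discrete_op d h i.+1]. *)
have W (i : nat) : (i < m)%N -> 0 <= h i.+1%:Z * s i - h i%:Z * s i.+1.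
  elim: i => [|i IHi] im; first by rewrite h0 /s mul0r sin0; lra.
  have := IHi (ltnW im); rewrite ss.
  have := ler_wpM2r (s_ge0 _ (ltnW im)) (hh i).
  lra.
elim=> [|[|i] IHi] im; rewrite ?h0//.
have /W := im.
have /IHi : (i.+1 <= m)%N by exact: ltnW.
have := s_ge0 _ im; have := s_gt0 i.+1 im => s1 s2 hi W1.
have : 0 <= h i.+2 * s i.+1.
  by have := mulr_ge0 hi s2; lra.
by rewrite pmulr_lge0.
Qed.

(** Geometrically, the vertex between the edges [j] and [j + 1] of a convex polygon is at the
    origin, which then belongs to the polygon. The half-period estimate is applied forwards from [j]
    and, after the reflection [k -> 1 - k], backwards from [j + 1]; together they cover the
    circle. *)
Lemma discrete_op_ge0 h j : int_periodic N h -> h j = 0 -> h (j + 1) = 0 ->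
  (forall i, 0 <= discrete_op d h i) -> forall i, 0 <= h i.
Proof.
move=> hN h0 h1 Lh i.
pose g k := h (k + j); pose g' k := h (1 - k + j).
have gN : int_periodic N g by move=> k; rewrite /g addrAC hN.
have gp : forall i : nat, (i <= m)%N -> 0 <= g i%:Z.
  apply: (@discrete_op_ge0_half g) => [||k]; rewrite /g.
  - by rewrite add0r.
  - by rewrite addrC h1.
  by have := Lh (k + j); rewrite /discrete_op ![k + _ + j]addrAC.
have gm : forall i : nat, (i <= m)%N -> 0 <= g' i%:Z.
  apply: (@discrete_op_ge0_half g') => [||k]; rewrite /g'.
  - by rewrite subr0 addrC h1.
  - by rewrite subrr add0r h0.
  have := Lh (1 - k + j); rewrite /discrete_op.
  rewrite (_ : 1 - k + j + 1 = 1 - (k - 1) + j); last by lia.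
  by rewrite (_ : 1 - k + j - 1 = 1 - (k + 1) + j); [lra|lia].
rewrite -(subrK j i) -/(g (i - j)); apply: (@int_periodic_ind N (fun k => 0 <= g k)) => //.
- by rewrite double_gt0.
- by move=> k; rewrite gN.
- by move=> k; rewrite gN.
- move=> k kN; case: (leqP k m) => [/gp//|mk].
  have : (N.+1 - k <= m)%N by rewrite /N; lia.
  move=> /gm.
  rewrite /g' /g => H.
  suff -> : k%:Z + j = 1 - (N.+1 - k)%:Z + j + N%:Z by rewrite hN.
  by rewrite /N in kN *; lia.
Qed.

(** The coefficients make the wave agree with [h] at 0 and 1. Both differences then satisfy
    [discrete_op_ge0], so they vanish. *)
Lemma discrete_op_eq0 h : int_periodic N h -> 0 < sin d ->
  (forall i, discrete_op d h i = 0) ->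
  exists a b, forall i, h i = a * cos (i%:~R * d) + b * sin (i%:~R * d).
Proof.
move=> hN sd Lh; exists (h 0), ((h 1 - h 0 * cos d) / sin d) => i.
set a := h 0; set b := (_ / _).
pose g k := a * cos (k%:~R * d) + b * sin (k%:~R * d).
have gN : int_periodic N g by move=> k; rewrite /g cos_periodic sin_periodic.
have hg0 : h 0 = g 0 by rewrite /g mul0r cos0 sin0 mulr0 addr0 mulr1.
have hg1 : h 1 = g 1.
  by rewrite /g mul1r /b divfK ?gt_eqF// /a; ring.
have Lg k : discrete_op d g k = 0 by exact: discrete_op_wave.
apply/eqP; rewrite -subr_eq0 eq_le; apply/andP; split.
  rewrite -oppr_ge0 opprB -/(g i).
  apply: (@discrete_op_ge0 (fun i => g i - h i) 0) => [k|||k].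
  - by rewrite hN gN.
  - by rewrite hg0 subrr.
  - by rewrite add0r hg1 subrr.
  - by rewrite discrete_opB Lg Lh subrr.
apply: (@discrete_op_ge0 (fun i => h i - g i) 0) => [k|||k].
- by rewrite hN gN.
- by rewrite hg0 subrr.
- by rewrite add0r hg1 subrr.
- by rewrite discrete_opB Lg Lh subrr.
Qed.

Definition abs_sin (k : int) : R := `|sin (k%:~R * d)|.

Lemma abs_sin_periodic : int_periodic m abs_sin.
Proof. by move=> k; rewrite /abs_sin intrD mulrDl step_half sinDpi normrN. Qed.

Lemma abs_sin_le1 k : abs_sin k <= 1.
Proof. exact: sin_max. Qed.

(** Since [sin] is annihilated, its absolute value contributes only where the sign changes: a
    segment is a degenerate polygon with two edges, in opposite directions. *)
Lemma discrete_op_abs_sin (k : int) : 0 <= sin d ->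
  discrete_op d abs_sin k = if (m%:Z %| k)%Z then 2 * sin d else 0.
Proof.
move=> sd; have dN j : (m%:Z %| j + m%:Z)%Z = (m%:Z %| j)%Z by rewrite rpredDr// dvdzz.
apply: (@int_periodic_ind m (fun k => discrete_op d abs_sin k = _)) => //.
- by move=> i; rewrite (int_periodic_op d abs_sin_periodic) dN.
- by move=> i; rewrite (int_periodic_op d abs_sin_periodic) dN.
move=> [|i] im.
  rewrite dvdz0 /discrete_op add0r sub0r /abs_sin mulN1r sinN normrN mul1r mul0r.
  by rewrite sin0 normr0 ger0_norm//; ring.
rewrite (_ : (_ %| _)%Z = false); last first.
  by apply/negbTE; rewrite /dvdz /=; apply/negP => /dvdn_leq; lia.
rewrite /discrete_op /abs_sin.
have nn (j : int) : 0 <= j <= m%:Z -> `|sin (j%:~R * d)| = sin (j%:~R * d).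
  move=> /andP[j0 jm]; rewrite ger0_norm//; apply: sin_ge0_pi.
  rewrite mulr_ge0 ?step_ge0 ?ler0z//=.
  by rewrite -step_half ler_wpM2r ?step_ge0// -[m%:R]/(m%:Z%:~R) ler_int.
rewrite !nn; [|lia..].
by have := discrete_op_wave d 0 1 i.+1; rewrite /discrete_op !mul0r !add0r !mul1r.
Qed.

End grid.
End DiscreteCalculus.

(** * Real analysis *)

Section RealPreliminaries.
Variable R : realType.
Implicit Types (x y s p d w t eps a b C : R).

Lemma ultra_bounded_cvg (U : set_system nat) (UU : UltraFilter U) (x : nat -> R) C :
  (\forall n \near U, `|x n| <= C) -> exists l : R, x @ U --> l.
Proof.
move=> xC; have : `[- C, C] `&` cluster (x @ U) !=set0.
  apply: segment_compact; apply: filterS xC => n.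
  by rewrite ler_norml /= in_itv.
move=> [l [_ lx]]; exists l => B Bl.
have [//|UB] := in_ultra_setVsetC (x @^-1` B) UU.
by have [z []] := lx (~` B) B UB Bl.
Qed.

Lemma continuous_bounded_itv (phi : R -> R) a b : continuous phi ->
  exists2 M : R, 0 <= M & forall x, a <= x <= b -> `|phi x| <= M.
Proof.
move=> cphi; have [ba|ab] := ltP b a.
  by exists 0 => // x /andP[ax /(le_trans ax)]; rewrite leNgt ba.
have cw : {within `[a, b], continuous (fun x => `|phi x|)}.
  by apply: continuous_subspaceT => x; apply: continuous_comp; [exact: cphi|exact: norm_continuous].
have [c _ hc] := EVT_max ab cw.
by exists `|phi c| => // x; rewrite -in_itv; exact: hc.
Qed.

(** Uniform continuity with an additive error, valid without a smallness condition on [x - y]: the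
    linear term can be summed over cells and tends to 0 with the mesh. *)
Lemma uniform_modulus (phi : R -> R) a b eps : continuous phi -> 0 < eps ->
  exists2 C : R, 0 <= C & forall x y, a <= x <= b -> a <= y <= b ->
    `|phi x - phi y| <= eps + C * `|x - y|.
Proof.
move=> cphi e0; have [ba|ab] := ltP b a.
  by exists 0 => // x y /andP[ax /(le_trans ax)]; rewrite leNgt ba.
have unif : \forall eta \near 0^'+, `[a, b] `<=`
    (fun x => forall y, `|x - y| < eta -> `|phi x - phi y| <= eps).
  have /compact_near_coveringP H := @segment_compact R a b.
  apply: (H _ 0^'+ (fun eta x => forall y, `|x - y| < eta -> `|phi x - phi y| <= eps)) => x _.
  have : \forall z \near x, `|phi x - phi z| < eps / 2.
    by move/cvgrPdist_lt : (cphi x); apply; rewrite divr_gt0.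
  move=> /nbhs_ballP[r /= r0 Br].
  exists (ball x (r / 2), [set eta | eta < r / 2]) => /=.
    split; first by apply: nbhsx_ballx; rewrite divr_gt0.
    by apply: nbhs_right_lt; rewrite divr_gt0.
  move=> [z eta] /= [xz er] y zy.
  have h1 := Br z (le_ball _ xz); have h2 : `|phi x - phi y| < eps / 2.
    apply: Br; rewrite /ball /= in xz *.
    rewrite -(subrKA z) (le_lt_trans (ler_normD _ _))// (splitr r).
    by rewrite ltrD// (lt_trans zy).
  rewrite -(subrKA (phi x)) (le_trans (ler_normD _ _))// (splitr eps) lerD//.
    by rewrite distrC ltW// h1//; lra.
  exact: ltW.
have [M M0 hM] := continuous_bounded_itv a b cphi.
near (0 : R)^'+ => eta.
have eta0 : 0 < eta by [].
have He : `[a, b] `<=` (fun x => forall y, `|x - y| < eta -> `|phi x - phi y| <= eps).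
  by near: eta.
exists (2 * M / eta); first by rewrite divr_ge0 ?mulr_ge0// ltW.
have K0 : 0 <= 2 * M / eta by rewrite divr_ge0 ?mulr_ge0// ltW.
move=> x y xab yab; have [xy|xy] := ltP `|x - y| eta.
  have /(_ y xy) h : forall y, `|x - y| < eta -> `|phi x - phi y| <= eps.
    by apply: He; rewrite /= in_itv.
  by rewrite (le_trans h)// lerDl mulr_ge0.
rewrite (le_trans (ler_normB _ _))//.
rewrite (@le_trans _ _ (2 * M))//; first by rewrite mulr2n mulrDl mul1r lerD ?hM.
rewrite -[leLHS]add0r lerD ?(ltW e0)//.
by rewrite mulrAC ler_pdivlMr// ler_wpM2l ?mulr_ge0.
Unshelve. all: by end_near. Qed.

(** Young's inequality with the conjugate exponents [1 / p] and [1 / (1 - p)], applied to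
    [(y / x) ^ p] and 1. It includes [y = 0], where the power is not differentiable. *)
Lemma powR_tangent p x y : 0 < p -> p < 1 -> 0 < x -> 0 <= y ->
  y `^ p <= x `^ p + p * x `^ (p - 1) * (y - x).
Proof.
move=> p0 p1 x0 y0; have q0 : 0 < 1 - p by lra.
have s0 : 0 <= y / x by rewrite divr_ge0// ltW.
have := @conjugate_powR R ((y / x) `^ p) 1 p^-1 (1 - p)^-1 (powR_ge0 _ _) ler01.
rewrite !invr_gt0 !invrK => /(_ p0 q0 (subrKC _ _)).
rewrite mulr1 powR1 mul1r -powRrM mulfV ?gt_eqF// powRr1// => h.
have yE : y = y / x * x by rewrite divfK ?gt_eqF.
rewrite [in leLHS]yE powRM ?(ltW x0)//.
have xp : 0 < x `^ p by rewrite powR_gt0.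
have xE : x `^ (p - 1) = x `^ p / x by rewrite powRB ?powRr1 ?(ltW x0)// (gt_eqF x0) implybT.
rewrite xE (le_trans (ler_wpM2r (ltW xp) h))//.
by rewrite le_eqVlt; apply/orP; left; apply/eqP; field; rewrite gt_eqF.
Qed.

Lemma powR_subadd s x y : 0 < s -> s <= 1 -> 0 <= x -> 0 <= y ->
  (x + y) `^ s <= x `^ s + y `^ s.
Proof.
move=> s0 s1; rewrite le_eqVlt => /predU1P[<-|x0].
  by rewrite add0r powR0 ?gt_eqF// add0r.
rewrite le_eqVlt => /predU1P[<-|y0].
  by rewrite addr0 powR0 ?gt_eqF// addr0.
have z0 : 0 < x + y by rewrite addr_gt0.
have H t : 0 < t <= x + y -> t / (x + y) * (x + y) `^ s <= t `^ s.
  move=> /andP[t0 tz]; have -> : t `^ s = (t / (x + y)) `^ s * (x + y) `^ s.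
    by rewrite -powRM ?divfK ?gt_eqF// ?divr_ge0 ?(ltW t0) ?(ltW z0).
  rewrite ler_wpM2r ?powR_ge0//; apply: ger1_powR => //.
  by rewrite divr_gt0//= ler_pdivrMr// mul1r.
have := lerD (H x _) (H y _); rewrite -!mulrDl mulfV ?gt_eqF// mul1r.
by apply; rewrite ?x0 ?y0 /=; lra.
Qed.

(** An estimate uniform down to 0 is required: no positive lower bound on the support numbers
    independent of [m] is available, and for [s < 1] the slope of the power is infinite at 0. *)
Lemma powR_holder s x y : 0 < s -> s <= 1 -> 0 <= x -> 0 <= y ->
  `|x `^ s - y `^ s| <= `|x - y| `^ s.
Proof.
move=> s0 s1; wlog xy : x y / y <= x => [H x0 y0|x0 y0].
  by case: (leP y x) => [/H|/ltW/H] => [|H1]; [exact|rewrite distrC (distrC x) H1].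
rewrite ger0_norm ?subr_ge0; last by rewrite ge0_ler_powR ?nnegrE// ltW.
rewrite ger0_norm ?subr_ge0// lerBlDr.
by rewrite (le_trans _ (powR_subadd s0 s1 _ _)) ?subr_ge0// subrK.
Qed.

Lemma continuous_norm_powR s : 0 < s -> s <= 1 -> continuous (fun x : R => `|x| `^ s).
Proof.
move=> s0 s1 x; apply/cvgrPdist_le => eps e0.
have h0 : 0 < eps `^ s^-1 by rewrite powR_gt0.
have : \forall t \near x, `|x - t| < eps `^ s^-1.
  by apply/nbhs_ballP; exists (eps `^ s^-1).
apply: filterS => t xt; rewrite (le_trans (powR_holder _ _ _ _))//.
have -> : eps = (eps `^ s^-1) `^ s.
  by rewrite -powRrM mulVf ?gt_eqF// powRr1// ltW.
rewrite ge0_ler_powR ?nnegrE ?powR_ge0 ?(ltW s0)//.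
by rewrite (le_trans (ler_dist_dist _ _))// ltW.
Qed.

Lemma derive_lipschitz (g dg : R -> R) x y : (forall z : R, is_derive z 1 g (dg z)) ->
  (forall z, `|dg z| <= 1) -> `|g x - g y| <= `|x - y|.
Proof.
move=> Dg dg1; wlog : x y / y < x => [H|yx].
  have [->|xy] := eqVneq x y; first by rewrite !subrr.
  case: (ltgtP y x) xy => // [yx|xy] _; first exact: H.
  by rewrite distrC (distrC x); exact: H.
have cg : continuous g.
  by move=> z; apply/differentiable_continuous/derivable1_diffP; case: (Dg z).
have [c _ ->] := MVT yx (fun z _ => Dg z) (continuous_subspaceT cg).
by rewrite normrM ler_piMl.
Qed.

Lemma cos_lipschitz x y : `|cos x - cos y| <= `|x - y|.
Proof.
apply: (@derive_lipschitz (@cos R) (fun z => - sin z)) => z.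
by rewrite normrN sin_max.
Qed.

Lemma sin_lipschitz x y : `|sin x - sin y| <= `|x - y|.
Proof. by apply: (@derive_lipschitz (@sin R) (@cos R)) => z; exact: cos_max. Qed.

Lemma sin_le_id d : 0 <= d -> `|sin d| <= d.
Proof. by move=> d0; have := sin_lipschitz d 0; rewrite sin0 !subr0 (ger0_norm d0). Qed.

Lemma cos_ge_quadratic d : 2 - 2 * cos d <= d ^+ 2.
Proof.
wlog d0 : d / 0 <= d => [H|].
  by case: (leP 0 d) => [/H//|d0]; rewrite -cosN -sqrrN H// oppr_ge0 ltW.
have dE : d = (d / 2) *+ 2 by rewrite -mulr_natr divfK.
rewrite [in cos d]dE cos_mulr2n cos2sin2 mulr2n.
have := sin_le_id (divr_ge0 d0 (@ler0n R 2)) => H.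
have : sin (d / 2) ^+ 2 <= (d / 2) ^+ 2.
  by rewrite -[leLHS]real_normK ?num_real// lerXn2r ?nnegrE// divr_ge0.
rewrite expr_div_n; lra.
Qed.

Lemma sin_ge_half d : 0 < d -> d <= 1 -> d / 2 <= sin d.
Proof.
move=> d0 d1.
have [c] := MVT d0 (fun x _ => is_derive_sin x) (continuous_subspaceT (@continuous_sin R)).
rewrite in_itv /= => /andP[c0 cd]; rewrite sin0 !subr0 => ->.
rewrite mulrC ler_pM2r//.
have := cos_ge_quadratic c.
have : c ^+ 2 <= 1 by rewrite expr_le1// ?ltW//; lra.
lra.
Qed.

(** The error is measured by the oscillation of [phi2], so no third derivative enters. The mean
    value theorem is applied to the even expression [k], then to its derivative [k1], which vanishes
    at 0. *)
Lemma second_difference (phi phi1 phi2 : R -> R) t d w : 0 < d ->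
  (forall x, is_derive x 1 phi (phi1 x)) -> (forall x, is_derive x 1 phi1 (phi2 x)) ->
  (forall x, `|x - t| <= d -> `|phi2 x - phi2 t| <= w) ->
  `|phi (t + d) + phi (t - d) - 2 * phi t - d ^+ 2 * phi2 t| <= 2 * w * d ^+ 2.
Proof.
move=> d0 D1 D2 hw.
pose k (s : R) := phi (t + s) + phi (t - s) - s ^+ 2 * phi2 t.
pose k1 (s : R) := phi1 (t + s) - phi1 (t - s) - 2 * s * phi2 t.
pose k2 (s : R) := phi2 (t + s) + phi2 (t - s) - 2 * phi2 t.
have comp (f g : R -> R) e : (forall x, is_derive x 1 f (g x)) ->
    forall s : R, is_derive s 1 (fun s => f (t + e * s)) (e * g (t + e * s)).
  move=> fg s; have gs : is_derive s 1 (cst t + e \*: (@id R)) e.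
    by apply: is_derive_eq; rewrite add0r /GRing.scale /= mulr1.
  by have := is_derive1_comp (fg _) gs; rewrite mulrC.
have compD (f g : R -> R) : (forall x, is_derive x 1 f (g x)) ->
    forall s : R, is_derive s 1 (fun s => f (t + s)) (g (t + s)).
  move=> fg s; have := comp f g 1 fg s; rewrite !mul1r.
  by under eq_fun do rewrite mul1r.
have compN (f g : R -> R) : (forall x, is_derive x 1 f (g x)) ->
    forall s : R, is_derive s 1 (fun s => f (t - s)) (- g (t - s)).
  move=> fg s; have := comp f g (-1) fg s; rewrite !mulN1r.
  by under eq_fun do rewrite mulN1r.
have Dk s : is_derive s 1 k (k1 s).
  have := compD _ _ D1 s; have := compN _ _ D1 s => h1 h2.
  rewrite /k; apply: is_derive_eq; rewrite /k1 /GRing.scale /=; ring.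
have Dk1 s : is_derive s 1 k1 (k2 s).
  have := compD _ _ D2 s; have := compN _ _ D2 s => h1 h2.
  rewrite /k1; apply: is_derive_eq; rewrite /k2 /GRing.scale /=; ring.
have ck (f g : R -> R) : (forall x, is_derive x 1 f (g x)) -> continuous f.
  by move=> fg x; apply/differentiable_continuous/derivable1_diffP; case: (fg x).
have k1b s : 0 < s <= d -> `|k1 s| <= 2 * w * s.
  move=> /andP[s0 sd].
  have [c] := MVT s0 (fun x _ => Dk1 x) (continuous_subspaceT (ck _ _ Dk1)).
  rewrite in_itv /= => /andP[c0 cs].
  rewrite {2}/k1 !addr0 !subr0 mulr0 mul0r subrr !subr0 => ->.
  rewrite normrM (gtr0_norm s0) ler_wpM2r ?(ltW s0)//.
  have -> : k2 c = (phi2 (t + c) - phi2 t) + (phi2 (t - c) - phi2 t) by rewrite /k2; ring.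
  rewrite (le_trans (ler_normD _ _))// mulr2n mulrDl mul1r lerD// hw//.
    by rewrite addrC addKr gtr0_norm//; lra.
  by rewrite addrC addKr normrN gtr0_norm//; lra.
have [c] := MVT d0 (fun x _ => Dk x) (continuous_subspaceT (ck _ _ Dk)).
rewrite in_itv /= => /andP[c0 cd].
rewrite /k !addr0 !subr0 expr0n /= mul0r subr0 => E.
have -> : phi (t + d) + phi (t - d) - 2 * phi t - d ^+ 2 * phi2 t = k1 c * d.
  by rewrite -E; ring.
rewrite normrM (gtr0_norm d0) expr2 mulrA ler_wpM2r ?(ltW d0)//.
have w0 : 0 <= w by apply: le_trans (hw t _); rewrite ?normr_ge0// subrr normr0 ltW.
have /k1b/le_trans : 0 < c <= d by rewrite c0 ltW.
by apply; rewrite ler_wpM2l ?mulr_ge0// ltW.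
Qed.

End RealPreliminaries.

(** * The discrete Minkowski problem *)

Section DiscreteMinkowski.
Variables (R : realType) (m : nat).
Hypothesis m4 : (4 <= m)%N.
Let m0 : (0 < m)%N. Proof. by apply: leq_trans m4. Qed.
Let N := m.*2.
Let d : R := pi / m%:R.
Implicit Types (h g v : int -> R).

Lemma period_gt0 : (0 < N)%N. Proof. by rewrite double_gt0. Qed.

Let d0 : 0 < d. Proof. exact: step_gt0. Qed.

(** This is the purpose of the hypothesis [4 <= m], since [pi < 4]; it yields [sin d >= d / 2]. *)
Lemma step_le1 : d <= 1.
Proof.
rewrite ler_pdivrMr ?ltr0n// mul1r.
have := @pihalf_lt2 R; rewrite ltr_pdivrMr// => h.
by rewrite (le_trans (ltW h))// -natrM ler_nat.
Qed.

Lemma sin_step_ge : d / 2 <= sin d.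
Proof. by apply: sin_ge_half => //; exact: step_le1. Qed.

Let sd0 : 0 < sin d.
Proof. by apply: lt_le_trans sin_step_ge; rewrite divr_gt0. Qed.

(* Up to the factor [sin d / d], the length of the edge with normal angle
   [i * d] of the polygon whose support numbers at the multiples of [d] are
   given by [h]. *)
Definition edge h i := discrete_op d h i / d.

Lemma int_periodic_edge h : int_periodic N h -> int_periodic N (edge h).
Proof. by move=> hN i; rewrite /edge int_periodic_op. Qed.

Lemma edgeB h g i : edge (fun i => h i - g i) i = edge h i - edge g i.
Proof. by rewrite /edge discrete_opB mulrBl. Qed.

Lemma edge_lin h g t i : edge (fun i => h i + t * g i) i = edge h i + t * edge g i.
Proof. by rewrite /edge discrete_op_lin mulrDl mulrA. Qed.

Lemma edge_wave a b i : edge (fun i => a * cos (i%:~R * d) + b * sin (i%:~R * d)) i = 0.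
Proof. by rewrite /edge discrete_op_wave mul0r. Qed.

Lemma wave_periodic a b :
  int_periodic N (fun i => a * cos (i%:~R * d) + b * sin (i%:~R * d)).
Proof. by move=> i; rewrite (cos_periodic _ m0) (sin_periodic _ m0). Qed.

Lemma edge_sym h g : int_periodic N h -> int_periodic N g ->
  \sum_(i < N) h i%:Z * edge g i%:Z = \sum_(i < N) g i%:Z * edge h i%:Z.
Proof.
move=> hN gN; rewrite /edge.
under eq_bigr do rewrite mulrA; under [RHS]eq_bigr do rewrite mulrA.
by rewrite -!mulr_suml (discrete_op_sym _ hN gN).
Qed.

(** The closing condition of the polygon: by symmetry the second difference falls on the wave, which
    has no edges. *)
Lemma sum_wave_edge a b h : int_periodic N h ->
  \sum_(i < N) (a * cos (i%:Z%:~R * d) + b * sin (i%:Z%:~R * d)) * edge h i%:Z = 0.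
Proof.
move=> hN.
rewrite (edge_sym (wave_periodic a b) hN) big1// => i _.
by rewrite edge_wave mulr0.
Qed.

(** The symmetry tested against the constant 1, the support numbers of the unit disc: a discrete
    form of Cauchy's perimeter formula. *)
Lemma sum_edge h : int_periodic N h ->
  \sum_(i < N) edge h i%:Z = (2 - 2 * cos d) / d * \sum_(i < N) h i%:Z.
Proof.
move=> hN; have := @edge_sym (fun=> 1) h (fun=> erefl) hN.
under eq_bigr do rewrite mul1r; move=> ->.
by rewrite mulr_sumr; apply: eq_bigr => i _; rewrite /edge discrete_op_const mulrC.
Qed.

Lemma sum_edge_le h : int_periodic N h -> (forall i, 0 <= h i) ->
  \sum_(i < N) edge h i%:Z <= d * \sum_(i < N) h i%:Z.
Proof.
move=> hN h0; rewrite sum_edge// ler_wpM2r ?sumr_ge0//.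
by rewrite ler_pdivrMr// -expr2 cos_ge_quadratic.
Qed.

Lemma term_le_sum (F : int -> R) i : int_periodic N F -> (forall i, 0 <= F i) ->
  F i <= \sum_(j < N) F j%:Z.
Proof.
move=> FN F0; rewrite -(sum_shift i FN).
by rewrite (bigD1 (Ordinal period_gt0))//= add0r lerDl sumr_ge0.
Qed.

(** The point [(a, b)] is the vertex common to the edges [j] and [j + 1]. Moving it to the origin
    creates two consecutive zeros, and [discrete_op_ge0] places it in the polygon. *)
Lemma normalize_translation h (j : int) : int_periodic N h -> (forall i, 0 < edge h i) ->
  exists a b, [/\ forall i, a * cos (i%:~R * d) + b * sin (i%:~R * d) <= h i,
    a * cos (j%:~R * d) + b * sin (j%:~R * d) = h j &
    a * cos ((j + 1)%:~R * d) + b * sin ((j + 1)%:~R * d) = h (j + 1)].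
Proof.
move=> hN h0; set x := j%:~R * d.
have xE : (j + 1)%:~R * d = x + d by rewrite intrD mulrDl mul1r.
(* The coordinates of the vertex in the frame made of the normal of angle [x] and its rotation by a
   right angle are [h j] and [b']. *)
pose b' := (h (j + 1) - h j * cos d) / sin d.
pose a := h j * cos x - b' * sin x; pose b := h j * sin x + b' * cos x.
have c1 := cos2Dsin2 x.
have e0 : a * cos x + b * sin x = h j.
  transitivity (h j * (cos x ^+ 2 + sin x ^+ 2)); first by rewrite /a /b; ring.
  by rewrite c1 mulr1.
have e1 : a * cos (x + d) + b * sin (x + d) = h (j + 1).
  rewrite cosD sinD.
  transitivity ((h j * cos d + b' * sin d) * (cos x ^+ 2 + sin x ^+ 2)).
    by rewrite /a /b; ring.
  by rewrite c1 mulr1 /b' divfK ?gt_eqF//; ring.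
exists a, b; split => //; last by rewrite xE.
move=> i; rewrite -subr_ge0.
apply: (@discrete_op_ge0 _ _ m0
  (fun i => h i - (a * cos (i%:~R * d) + b * sin (i%:~R * d))) j) => [k|||k].
- by rewrite hN (wave_periodic a b).
- by rewrite -/x e0 subrr.
- by rewrite xE e1 subrr.
- rewrite discrete_opB discrete_op_wave subr0.
  by have := ltW (h0 k); rewrite /edge pmulr_lge0// invr_gt0.
Qed.

(** * The energy: competitor, coercivity and minimizer *)

Variables (p : R) (p0 : 0 < p) (p1 : p < 1) (alpha : int -> R).
Hypotheses (alphaN : int_periodic N alpha) (alpha_gt0 : forall i, 0 < alpha i).
Let q := p / (1 - p).
Let q0 : 0 < q. Proof. by rewrite divr_gt0 ?subr_gt0. Qed.

Definition barrier h := \sum_(i < N) alpha i%:Z `^ (1 + q) * edge h i%:Z `^ (- q).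
(** Up to the factor contained in [edge], twice the area of the polygon. By the symmetry of [edge]
    it is a quadratic form with gradient [2 * edge h]. *)
Definition area2 h := \sum_(i < N) h i%:Z * edge h i%:Z.
Definition energy h := area2 h / 2 + barrier h / q.
Definition admissible h := int_periodic N h /\ forall i, 0 < edge h i.

Lemma barrier_ge0 h : 0 <= barrier h.
Proof. by apply: sumr_ge0 => i _; rewrite mulr_ge0 ?powR_ge0. Qed.

Lemma area2_translate h a b : int_periodic N h ->
  area2 (fun i => h i - (a * cos (i%:~R * d) + b * sin (i%:~R * d))) = area2 h.
Proof.
move=> hN; rewrite /area2.
under eq_bigr do rewrite edgeB edge_wave subr0 mulrBl.
by rewrite sumrB sum_wave_edge// subr0.
Qed.

Lemma barrier_eq h g : (forall i, edge h i = edge g i) -> barrier h = barrier g.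
Proof. by move=> hg; apply: eq_bigr => i _; rewrite hg. Qed.

Lemma admissible_nonneg h : admissible h ->
  exists g, [/\ admissible g, forall i, 0 <= g i & energy g = energy h].
Proof.
move=> [hN h0]; have [a [b [hab _ _]]] := normalize_translation 0 hN h0.
pose g i := h i - (a * cos (i%:~R * d) + b * sin (i%:~R * d)).
have ge i : edge g i = edge h i by rewrite /g edgeB edge_wave subr0.
exists g; split.
- by split=> i; rewrite ?ge// /g hN (wave_periodic a b).
- by move=> i; rewrite /g subr_ge0.
- by rewrite /energy area2_translate// (barrier_eq ge).
Qed.

Lemma area2_ge0 h : (forall i, 0 <= h i) -> (forall i, 0 < edge h i) -> 0 <= area2 h.
Proof. by move=> h0 e0; apply: sumr_ge0 => i _; rewrite mulr_ge0// ltW. Qed.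

Lemma energy_ge0 h : admissible h -> 0 <= energy h.
Proof.
move=> /admissible_nonneg[g [[_ g0] gg <-]].
by rewrite addr_ge0// divr_ge0 ?barrier_ge0 ?area2_ge0// ltW.
Qed.

(** Support numbers of the Minkowski sum of centred segments orthogonal to the grid normals, the
    [j]-th of half length [alpha j]. It is the competitor that bounds the minimal energy. *)
Definition zonotope : int -> R :=
  fun i => \sum_(j < N) alpha j%:Z * abs_sin R m (i - j%:Z).

Lemma zonotope_periodic : int_periodic N zonotope.
Proof.
move=> i; apply: eq_bigr => j _; congr (_ * _).
rewrite addrAC.
by have := int_periodicM 2 (i - j%:Z) (abs_sin_periodic R m0); rewrite (_ : 2 * m%:Z = N%:Z)//; lia.
Qed.

(** The [j]-th segment has two edges of value [alpha j * (2 * sin d / d)], at least [alpha j] since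
    [sin d >= d / 2]. The one with normal index [i] suffices, as all the others contribute
    nonnegatively. *)
Lemma zonotope_edge i : alpha i <= edge zonotope i.
Proof.
have E k : edge zonotope k = \sum_(j < N) alpha j%:Z * edge (abs_sin R m) (k - j%:Z).
  rewrite /edge /discrete_op /zonotope mulrBl mulrDl !mulr_suml mulr_sumr mulr_suml.
  rewrite -big_split -sumrB /=; apply: eq_bigr => j _.
  by rewrite [k + 1 - _]addrAC [k - 1 - _]addrAC; ring.
apply: (@int_periodic_ind N (fun i => alpha i <= edge zonotope i)) => {i} //.
- exact: period_gt0.
- by move=> i; rewrite alphaN (int_periodic_edge zonotope_periodic).
- by move=> i; rewrite alphaN (int_periodic_edge zonotope_periodic).
move=> i iN; rewrite E (bigD1 (Ordinal iN))//= subrr.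
have e0 k : 0 <= edge (abs_sin R m) k.
  rewrite /edge discrete_op_abs_sin ?(ltW sd0)//.
  by apply: divr_ge0; [case: ifP => _ //; rewrite mulr_ge0// ltW|exact: ltW].
rewrite (@le_trans _ _ (alpha i%:Z * edge (abs_sin R m) 0))//.
  rewrite ler_peMr ?(ltW (alpha_gt0 _))//.
  rewrite /edge discrete_op_abs_sin ?(ltW sd0)// dvdz0.
  by rewrite ler_pdivlMr// mul1r; have := sin_step_ge; lra.
by rewrite lerDl sumr_ge0// => j _; rewrite mulr_ge0 ?(ltW (alpha_gt0 _)).
Qed.

Lemma zonotope_admissible : admissible zonotope.
Proof.
split; first exact: zonotope_periodic.
by move=> i; rewrite (lt_le_trans _ (zonotope_edge i)).
Qed.

Let A := \sum_(i < N) alpha i%:Z.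

Lemma zonotope_ge0 i : 0 <= zonotope i.
Proof. by apply: sumr_ge0 => j _; rewrite mulr_ge0 ?(ltW (alpha_gt0 _))// /abs_sin. Qed.

(** Only the total mass [A] enters, so the bound is uniform in [m]. The perimeter bound and
    [zonotope i <= A] bound the doubled area by [2 * pi * A ^ 2]; as the edges dominate [alpha],
    each barrier term is at most [alpha i]. *)
Lemma energy_zonotope : energy zonotope <= pi * A ^+ 2 + A / q.
Proof.
have A0 : 0 <= A by apply: sumr_ge0 => i _; exact/ltW.
have zA i : zonotope i <= A.
  by apply: ler_sum => j _; rewrite ler_piMr ?abs_sin_le1// ltW.
have [_ e0] := zonotope_admissible.
apply: lerD; last first.
  rewrite ler_wpM2r ?invr_ge0 ?(ltW q0)//; apply: ler_sum => i _.
  rewrite powRD ?(gt_eqF (alpha_gt0 _)) ?implybT// powRr1 ?(ltW (alpha_gt0 _))//.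
  rewrite -mulrA ler_piMr ?(ltW (alpha_gt0 _))// powRN -/(_ / _).
  rewrite ler_pdivrMr ?powR_gt0// mul1r.
  by rewrite ge0_ler_powR ?nnegrE ?(ltW q0) ?(ltW (alpha_gt0 _)) ?(ltW (e0 _)) ?zonotope_edge.
rewrite ler_pdivrMr//.
apply: (@le_trans _ _ (\sum_(i < N) A * edge zonotope i%:Z)).
  by apply: ler_sum => i _; rewrite ler_wpM2r ?(ltW (e0 _)).
rewrite -mulr_sumr; apply: (@le_trans _ _ (A * (d * (A *+ N)))).
  rewrite ler_wpM2l// (le_trans (sum_edge_le zonotope_periodic zonotope_ge0))//.
  rewrite ler_wpM2l ?(ltW d0)// (le_trans (ler_sum _ (fun i _ => zA _)))//.
  by rewrite sumr_const card_ord.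
have -> : A * (d * (A *+ N)) = A ^+ 2 * (N%:R * d) by rewrite -[A *+ N]mulr_natl; ring.
by rewrite step_full// le_eqVlt; apply/orP; left; apply/eqP; ring.
Qed.

(** All terms being nonnegative, an edge is bounded below through its own barrier term, and then
    [h i] is bounded through its own area term. The constant depends on [alpha], [i] and [B]; it
    serves the existence for a fixed [m]. *)
Lemma energy_coercive B i : exists2 C : R, 0 < C &
  forall h, admissible h -> (forall i, 0 <= h i) -> energy h <= B ->
    C <= edge h i /\ h i <= 2 * B / C.
Proof.
pose F h (i : int) := alpha i `^ (1 + q) * edge h i `^ (- q).
(* The barrier is at most [q * B]; the larger [1 + q * |B|] is positive for every [B]. *)
pose C := (alpha i `^ (1 + q) / (1 + q * `|B|)) `^ q^-1.
have B0 : 0 < 1 + q * `|B| by rewrite ltr_pwDl// mulr_ge0 ?(ltW q0).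
have C0 : 0 < C by rewrite powR_gt0// divr_gt0 ?powR_gt0.
exists C => // h [hN e0] h0 hB.
have b0 := barrier_ge0 h; have a0 := area2_ge0 h0 e0.
have bB : barrier h <= q * B.
  rewrite mulrC -ler_pdivrMr//.
  by rewrite (le_trans _ hB)// /energy lerDr divr_ge0.
have aB : area2 h <= 2 * B.
  rewrite mulrC -ler_pdivrMr// (le_trans _ hB)// /energy lerDl.
  by rewrite divr_ge0// ltW.
have Ce : C <= edge h i.
  have := @term_le_sum (F h) i _ _.
  have FN : int_periodic N (F h).
    by move=> k; rewrite /F alphaN (int_periodic_edge hN).
  have F0 k : 0 <= F h k by rewrite mulr_ge0 ?powR_ge0.
  move=> /(_ FN F0); rewrite -/(barrier h) => /le_trans/(_ bB) hF.
  have eq0 : 0 < edge h i `^ q by rewrite powR_gt0.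
  have : alpha i `^ (1 + q) <= edge h i `^ q * (1 + q * `|B|).
    move: hF; rewrite /F powRN ler_pdivrMr// mulrC => /le_trans; apply.
    rewrite ler_wpM2l ?(ltW eq0)// ler_wpDl// ler_wpM2l ?(ltW q0)//.
    exact: ler_norm.
  rewrite -ler_pdivrMr// => H.
  have -> : edge h i = (edge h i `^ q) `^ q^-1.
    by rewrite -powRrM mulfV ?gt_eqF// powRr1// ltW.
  rewrite /C ge0_ler_powR ?nnegrE ?powR_ge0 ?invr_ge0 ?(ltW q0)//.
  by rewrite divr_ge0 ?powR_ge0// ltW.
split=> //; rewrite ler_pdivlMr//.
have := @term_le_sum (fun i => h i * edge h i) i _ _.
have FN : int_periodic N (fun i => h i * edge h i).
  by move=> k; rewrite hN (int_periodic_edge hN).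
have F0 k : 0 <= h k * edge h k by rewrite mulr_ge0// ltW.
move=> /(_ FN F0); rewrite -/(area2 h) => /le_trans/(_ aB).
by apply: le_trans; rewrite ler_wpM2l.
Qed.

Section convergence.
Context (U : set_system nat) {UF : ProperFilter U}.

Lemma cvg_sum_ord (n : nat) (F : nat -> int -> R) (a : int -> R) :
  (forall i, F k i @[k --> U] --> a i) ->
  \sum_(i < n) F k i%:Z @[k --> U] --> \sum_(i < n) a i%:Z.
Proof.
move=> H; apply: (@cvg_big _ _ +%R) => //; exact: add_continuous.
Qed.

Lemma cvg_edge (y : nat -> int -> R) h : (forall i, y k i @[k --> U] --> h i) ->
  forall i, edge (y k) i @[k --> U] --> edge h i.
Proof.
move=> yh i; rewrite /edge /discrete_op.
by apply: cvgMl; apply: cvgB; [apply: cvgD|apply: cvgMr].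
Qed.

Lemma cvg_powR_gt0 (x : nat -> R) (l s : R) : 0 < l -> x @ U --> l ->
  x k `^ s @[k --> U] --> l `^ s.
Proof.
move=> l0 xl; have : {for l, continuous (fun z : R => z `^ s)}.
  apply/differentiable_continuous/derivable1_diffP/derivable_powR.
  by rewrite in_itv /= l0.
exact: cvg_comp xl.
Qed.

Lemma cvg_energy (y : nat -> int -> R) h : (forall i, 0 < edge h i) ->
  (forall i, y k i @[k --> U] --> h i) -> energy (y k) @[k --> U] --> energy h.
Proof.
move=> e0 yh; have eh := cvg_edge yh; apply: cvgD; apply: cvgMl.
  apply: (@cvg_sum_ord N (fun k i => y k i * edge (y k) i) (fun i => h i * edge h i)) => i.
  exact: cvgM.
apply: (@cvg_sum_ord N (fun k i => alpha i `^ (1 + q) * edge (y k) i `^ (- q))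
  (fun i => alpha i `^ (1 + q) * edge h i `^ (- q))) => i.
by apply: cvgMr; apply: cvg_powR_gt0.
Qed.

End convergence.

(** A minimizing sequence is translated to nonnegative support numbers, so that coercivity applies.
    Its edges stay away from 0, hence the limit is admissible and the energy is continuous there. *)
Lemma energy_minimizer : exists2 h, admissible h &
  forall g, admissible g -> energy h <= energy g.
Proof.
pose E := [set energy g | g in admissible].
have E0 : has_inf E.
  split; first by exists (energy zonotope), zonotope => //; exact: zonotope_admissible.
  by exists 0 => _ [g + <-]; exact: energy_ge0.
have /choice[y yP] : forall k : nat, exists g, [/\ admissible g, forall i, 0 <= g i &
    energy g <= inf E + k.+1%:R^-1].
  move=> k; have [|_ [g ag <-] gk] := @inf_adherent _ E k.+1%:R^-1 _ E0; first by rewrite invr_gt0.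
  have [g' [ag' g'0 g'E]] := admissible_nonneg ag.
  by exists g'; split => //; rewrite g'E ltW.
have [U [UU oU]] := ultraFilterLemma eventually_filter.
have UP : ProperFilter U by exact: ultra_proper.
have yB k : energy (y k) <= inf E + 1.
  have [_ _ h] := yP k; rewrite (le_trans h)// lerD2l invf_le1// ler1n//.
have C i := energy_coercive (inf E + 1) i.
have /choice[h yh] : forall i, exists l : R, y k i @[k --> U] --> l.
  move=> i; have [c c0 hc] := C i.
  apply: (@ultra_bounded_cvg R U UU _ (2 * (inf E + 1) / c)).
  near=> k; have [ay y0 _] := yP k; have [_ +] := hc _ ay y0 (yB k).
  by rewrite ger0_norm.
have hN : int_periodic N h.
  move=> i; have := yh (i + N%:Z).
  have -> : (fun k => y k (i + N%:Z)) = (fun k => y k i).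
    by apply/funext => k; have [[yN _] _ _] := yP k; rewrite yN.
  by move=> /(cvg_unique _ (yh i)) ->.
have he i : 0 < edge h i.
  have [c c0 hc] := C i; apply: lt_le_trans c0 _.
  have ce : edge (y k) i @[k --> U] --> edge h i by exact: cvg_edge.
  apply: (cvgr_to_ge ce).
  by near=> k; have [ay y0 _] := yP k; have [+ _] := hc _ ay y0 (yB k).
exists h => // g ag; apply: (@le_trans _ _ (inf E)); last first.
  by apply: ge_inf; [case: E0|exists g].
have cJ : energy (y k) @[k --> U] --> energy h by exact: cvg_energy.
have cI : inf E + k.+1%:R^-1 @[k --> U] --> inf E + 0.
  apply: cvgD; first exact: cvg_cst.
  exact: cvg_trans (cvg_app _ oU) (@cvg_harmonic R).
rewrite -[leRHS]addr0; apply: ler_cvg_to cJ cI _.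
by near=> k; have [_ _] := yP k.
Unshelve. all: by end_near. Qed.

(** By homogeneity this reduces to [t ^ (- s) >= 1 - s * (t - 1)], which follows from
    [exp u >= 1 + u] and [ln t <= t - 1]. *)
Lemma powRN_tangent (s x y : R) : 0 < s -> 0 < x -> 0 < y ->
  x `^ (- s) - s * x `^ (- s - 1) * (y - x) <= y `^ (- s).
Proof.
move=> s0 x0 y0; have t0 : 0 < y / x by rewrite divr_gt0.
have yE : y = y / x * x by rewrite divfK ?gt_eqF.
have H : 1 - s * (y / x - 1) <= (y / x) `^ (- s).
  rewrite /powR gt_eqF//; apply: le_trans (expR_ge1Dx _).
  rewrite lerD2l mulNr lerN2 ler_wpM2l ?(ltW s0)//.
  have := @le_ln1Dx R (y / x - 1); rewrite [1 + _]addrC subrK; apply.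
  by rewrite ltrBrDr addNr.
rewrite [in leRHS]yE powRM ?(ltW x0) ?(ltW t0)//.
have -> : x `^ (- s - 1) = x `^ (- s) / x.
  by rewrite powRB ?powRr1 ?(ltW x0)// (gt_eqF x0) implybT.
have xs : 0 <= x `^ (- s) by exact: powR_ge0.
rewrite (le_trans _ (ler_wpM2r xs H))//.
by rewrite le_eqVlt; apply/orP; left; apply/eqP; field; rewrite gt_eqF.
Qed.

(* The convexity of [x `^ (- q)] bounds the energy of [h + t v] from above by an
   expression whose limit as [t] tends to [0+] is the first variation. *)
Lemma energy_variation h v : admissible h -> (forall g, admissible g -> energy h <= energy g) ->
  int_periodic N v ->
  0 <= \sum_(i < N) (h i%:Z - alpha i%:Z `^ (1 + q) * edge h i%:Z `^ (- q - 1)) * edge v i%:Z.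
Proof.
move=> [hN he] hmin vN.
pose t (k : nat) : R := k.+1%:R^-1.
have t0 k : 0 < t k by rewrite invr_gt0.
pose y k i := h i + t k * v i.
have yN k : int_periodic N (y k) by move=> i; rewrite /y hN vN.
have ct : t @ \oo --> (0 : R) by exact: cvg_harmonic.
have yh i : y k i @[k --> \oo] --> h i.
  by rewrite -[h i in X in _ --> X]addr0 -(mul0r (v i)); apply: cvgD; [exact: cvg_cst|exact: cvgMl].
have ye i : edge (y k) i @[k --> \oo] --> edge h i by exact: cvg_edge.
have adm : \forall k \near \oo, forall i, 0 < edge (y k) i.
  have : \forall k \near \oo, forall i : 'I_N, 0 < edge (y k) i%:Z.
    by apply: filter_forall => i; apply: cvgr_gt (ye i) _ _.
  apply: filterS => k H; apply: (@int_periodic_ind N (fun i => 0 < edge (y k) i)).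
  - exact: period_gt0.
  - by move=> i; rewrite (int_periodic_edge (yN k)).
  - by move=> i; rewrite (int_periodic_edge (yN k)).
  - by move=> i iN; exact: (H (Ordinal iN)).
pose b k := \sum_(i < N) (h i%:Z + t k / 2 * v i%:Z -
  alpha i%:Z `^ (1 + q) * edge (y k) i%:Z `^ (- q - 1)) * edge v i%:Z.
have b0 : \forall k \near \oo, 0 <= b k.
  near=> k.
  have ek : forall i, 0 < edge (y k) i by near: k.
  have := hmin (y k) (conj (yN k) ek).
  have aE : area2 (y k) = area2 h + 2 * t k * \sum_(i < N) h i%:Z * edge v i%:Z
      + t k ^+ 2 * \sum_(i < N) v i%:Z * edge v i%:Z.
    rewrite /area2 /y; under eq_bigr do rewrite edge_lin.
    transitivity (\sum_(i < N) h i%:Z * edge h i%:Z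
      + t k * \sum_(i < N) h i%:Z * edge v i%:Z
      + t k * \sum_(i < N) v i%:Z * edge h i%:Z
      + t k ^+ 2 * \sum_(i < N) v i%:Z * edge v i%:Z).
      rewrite !mulr_sumr -!big_split /=; apply: eq_bigr => i _; ring.
    by rewrite (edge_sym vN hN); ring.
  have bE : barrier (y k) <= barrier h - t k * q *
      \sum_(i < N) alpha i%:Z `^ (1 + q) * edge (y k) i%:Z `^ (- q - 1) * edge v i%:Z.
    rewrite /barrier mulr_sumr -sumrB; apply: ler_sum => i _.
    (* The tangent is taken at the perturbed edge, not at that of [h]: convexity then bounds the
       barrier of [y k] from above, as the use of minimality requires. *)
    have := powRN_tangent q0 (ek i) (he i).
    rewrite {2}/y edge_lin opprD addrA subrr add0r => H.
    have := ler_wpM2l (powR_ge0 (alpha i%:Z) (1 + q)) H; lra.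
  rewrite /energy aE => H.
  have : 0 <= t k * b k; last by rewrite pmulr_rge0.
  have -> : b k = \sum_(i < N) h i%:Z * edge v i%:Z
     + t k / 2 * (\sum_(i < N) v i%:Z * edge v i%:Z)
     - \sum_(i < N) alpha i%:Z `^ (1 + q) * edge (y k) i%:Z `^ (- q - 1) * edge v i%:Z.
    rewrite /b mulr_sumr -big_split -sumrB; apply: eq_bigr => i _ /=; ring.
  have qi0 : 0 <= q^-1 by rewrite invr_ge0 ltW.
  have := ler_wpM2r qi0 bE.
  rewrite mulrBl [t k * q * _ / q]mulrAC [t k * q / q]mulfK ?gt_eqF//.
  lra.
apply: cvgr_to_ge b0.
apply: (@cvg_sum_ord _ _ N (fun k i => (h i + t k / 2 * v i -
  alpha i `^ (1 + q) * edge (y k) i `^ (- q - 1)) * edge v i)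
  (fun i => (h i - alpha i `^ (1 + q) * edge h i `^ (- q - 1)) * edge v i)) => i.
apply: cvgMl; apply: cvgB; last by apply: cvgMr; exact: cvg_powR_gt0.
rewrite -[h i in X in _ --> X]addr0 -(mul0r (v i)) -(mul0r (2^-1)).
by apply: cvgD; [exact: cvg_cst|do 2!apply: cvgMl].
Unshelve. all: by end_near. Qed.

(** The first variation is tested with [v = - edge g] for [g = h - w]. By symmetry it becomes minus
    the sum of the squares of [edge g], so [g] is a wave and [w] is a translate of [h]. The solution
    is [w], not the minimizer [h] itself. *)
Theorem discrete_Minkowski : exists h, [/\ int_periodic N h, forall i, 0 < h i,
  forall i, 0 < edge h i, forall i, edge h i * h i `^ (1 - p) = alpha i &
  area2 h <= 2 * (pi * A ^+ 2 + A / q)].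
Proof.
have [h ah hmin] := energy_minimizer; have [hN he] := ah.
(* This is [(alpha i / edge h i) ^ (1 / (1 - p))]: positivity is built in, and so is the equation
   once [w] is known to have the edges of [h]. *)
pose w i := alpha i `^ (1 + q) * edge h i `^ (- q - 1).
have wN : int_periodic N w by move=> i; rewrite /w alphaN (int_periodic_edge hN).
pose g i := h i - w i.
have gN : int_periodic N g by move=> i; rewrite /g hN wN.
have ge0 i : edge g i = 0.
  pose v i := - edge g i.
  have vN : int_periodic N v by move=> k; rewrite /v (int_periodic_edge gN).
  have := energy_variation ah hmin vN.
  rewrite -/(g _) (edge_sym gN vN) /v => H.
  have F0 k : 0 <= edge g k ^+ 2 by exact: sqr_ge0.
  have := @term_le_sum (fun i => edge g i ^+ 2) i _ F0.
  have FN : int_periodic N (fun i => edge g i ^+ 2).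
    by move=> k; rewrite (int_periodic_edge gN).
  move=> /(_ FN) H2.
  have : edge g i ^+ 2 <= 0.
    apply: le_trans H2 _; rewrite -oppr_ge0 -sumrN (le_trans H)//.
    by apply: ler_sum => k _; rewrite expr2 mulNr.
  by rewrite le_eqVlt ltNge sqr_ge0 orbF sqrf_eq0 => /eqP.
have wE i : edge w i = edge h i.
  by apply/eqP; rewrite eq_sym -subr_eq0 -edgeB; apply/eqP/ge0.
have w0 i : 0 < w i by rewrite mulr_gt0 ?powR_gt0.
have q1 : (1 + q) * (1 - p) = 1 by rewrite /q; field; rewrite gt_eqF ?subr_gt0.
exists w; split => // [i|i|]; first by rewrite wE.
  rewrite wE /w powRM ?powR_ge0// -!powRrM.
  have -> : - q - 1 = - (1 + q) by ring.
  by rewrite mulNr q1 powRr1 ?(ltW (alpha_gt0 _))// powR_inv1 ?(ltW (he _))// mulrCA mulfV ?mulr1 ?gt_eqF.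
have og i : discrete_op d g i = 0.
  by move: (ge0 i) => /eqP; rewrite /edge mulf_eq0 invr_eq0 (gt_eqF d0) orbF => /eqP.
have [a [b gab]] := discrete_op_eq0 m0 gN sd0 og.
apply: (@le_trans _ _ (area2 h)).
  rewrite -(area2_translate a b hN) le_eqVlt; apply/orP; left; apply/eqP.
  have -> : (fun i => h i - (a * cos (i%:~R * d) + b * sin (i%:~R * d))) = w => //.
  by apply/funext => i; rewrite -gab /g; ring.
rewrite mulrC -ler_pdivrMr//.
apply: le_trans (energy_zonotope).
apply: le_trans (hmin _ zonotope_admissible).
by rewrite lerDl divr_ge0 ?barrier_ge0// ltW.
Qed.

End DiscreteMinkowski.

(** * A bound on the polygons uniform in the number of edges *)

Section DiscreteBounds.
Variables (R : realType) (m : nat).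
Hypothesis m4 : (4 <= m)%N.
Let m0 : (0 < m)%N. Proof. by apply: leq_trans m4. Qed.
Let N := m.*2.
Let d : R := pi / m%:R.
Variables (p : R) (p0 : 0 < p) (p1 : p < 1) (alpha h : int -> R) (B D : R).
Let M11 := \sum_(i < N) alpha i%:Z * cos (i%:Z%:~R * d) ^+ 2.
Let M12 := \sum_(i < N) alpha i%:Z * (cos (i%:Z%:~R * d) * sin (i%:Z%:~R * d)).
Let M22 := \sum_(i < N) alpha i%:Z * sin (i%:Z%:~R * d) ^+ 2.
Hypotheses (hN : int_periodic N h) (h_gt0 : forall i, 0 < h i)
  (h_edge : forall i, edge m h i * h i `^ (1 - p) = alpha i)
  (alpha_gt0 : forall i, 0 < alpha i)
  (hB : area2 m h <= B) (D0 : 0 < D) (DM : D <= M11 * M22 - M12 ^+ 2).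

(* Concavity of [t `^ p] and the closing condition [sum_wave_edge] show that
   [\sum_i alpha i * z i `^ p] is maximal, among the translates [z >= 0] of [h],
   at [h] itself. This is applied to the translation moving [(a, b) / 2] to the
   origin, for which [z] is bounded below by half the width of the segment from
   the origin to [(a, b)]. *)
Lemma translate_bound a b :
  (forall j, a * cos (j%:~R * d) + b * sin (j%:~R * d) <= h j) ->
  \sum_(i < N) alpha i%:Z *
    (`|a * cos (i%:Z%:~R * d) + b * sin (i%:Z%:~R * d)| / 2) `^ p <= B.
Proof.
move=> ab; pose x i := a * cos (i%:~R * d) + b * sin (i%:~R * d).
apply: le_trans hB; rewrite /area2.
have xe : \sum_(i < N) x i%:Z * edge m h i%:Z = 0 by exact: sum_wave_edge.
apply: (@le_trans _ _ (\sum_(i < N) (h i%:Z * edge m h i%:Z - p / 2 * (x i%:Z * edge m h i%:Z)))).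
  apply: ler_sum => -[i /= _] _; rewrite -/(x i%:Z).
  have xh : x i%:Z <= h i%:Z by exact: ab.
  have h0 := h_gt0 i%:Z.
  (* From [h i >= x i] when [x i] is nonnegative, and from [h i >= 0] otherwise. *)
  have zx : `|x i%:Z| / 2 <= h i%:Z - x i%:Z / 2.
    by rewrite ler_pdivrMr// ler_norml; apply/andP; split; lra.
  have z0 : 0 <= h i%:Z - x i%:Z / 2 by apply: le_trans zx; rewrite divr_ge0.
  have T := powR_tangent p0 p1 h0 z0.
  apply: (@le_trans _ _ (alpha i%:Z * (h i%:Z - x i%:Z / 2) `^ p)).
    rewrite ler_wpM2l ?(ltW (alpha_gt0 _))// ge0_ler_powR ?nnegrE ?(ltW p0)//.
  apply: le_trans (ler_wpM2l (ltW (alpha_gt0 _)) T) _.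
  have E1 : alpha i%:Z * h i%:Z `^ p = h i%:Z * edge m h i%:Z.
    rewrite -h_edge -mulrA -powRD; last by rewrite (gt_eqF h0) implybT.
    by rewrite subrK powRr1 ?(ltW h0)// mulrC.
  have E2 : alpha i%:Z * h i%:Z `^ (p - 1) = edge m h i%:Z.
    rewrite -h_edge -mulrA -powRD; last by rewrite (gt_eqF h0) implybT.
    by rewrite addrC subrKA subrr powRr0 mulr1.
  rewrite mulrDr E1 lerD2l -E2 le_eqVlt; apply/orP; left; apply/eqP; ring.
by rewrite sumrB -mulr_sumr xe mulr0 subr0.
Qed.

(** With [r] the length of [(a, b)], the ratio [|x i| / r] is at most 1, so its power [p] dominates
    its square. Then [translate_bound] gives [(r / 2) ^ p] times the sum of
    [alpha i * (x i / r) ^ 2] at most [B], and this second moment is at least the determinant of the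
    moment matrix divided by its trace. *)
Lemma vertex_bound a b :
  (forall j, a * cos (j%:~R * d) + b * sin (j%:~R * d) <= h j) ->
  let rho := 2 * ((M11 + M22) * B / D) `^ p^-1 in `|a| <= rho /\ `|b| <= rho.
Proof.
move=> ab rho; pose r := Num.sqrt (a ^+ 2 + b ^+ 2).
have r2 : r ^+ 2 = a ^+ 2 + b ^+ 2 by rewrite sqr_sqrtr// addr_ge0 ?sqr_ge0.
have r0 : 0 <= r by exact: sqrtr_ge0.
have ar : `|a| <= r by rewrite -sqrtr_sqr ler_wsqrtr// lerDl sqr_ge0.
have br : `|b| <= r by rewrite -sqrtr_sqr ler_wsqrtr// lerDr sqr_ge0.
suff : r <= rho by move=> rr; split; exact: le_trans rr.
move: r0; rewrite le_eqVlt => /predU1P[<-|r0]; first by rewrite mulr_ge0 ?powR_ge0.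
have tB := translate_bound ab.
pose x i := a * cos (i%:~R * d) + b * sin (i%:~R * d).
have M0 : 0 <= M11 + M22.
  by rewrite addr_ge0// sumr_ge0// => i _; rewrite mulr_ge0 ?sqr_ge0// ltW.
have xr i : `|x i| <= r.
  rewrite -(ler_pXn2r (ltn0Sn 1)) ?nnegrE ?(ltW r0)// real_normK ?num_real// r2.
  pose c := cos (i%:~R * d); pose s := sin (i%:~R * d).
  have -> : x i ^+ 2 = (a ^+ 2 + b ^+ 2) * (c ^+ 2 + s ^+ 2) - (a * s - b * c) ^+ 2.
    by rewrite /x -/c -/s; ring.
  by rewrite cos2Dsin2 mulr1 gerBl sqr_ge0.
have H : (r / 2) `^ p * \sum_(i < N) alpha i%:Z * x i%:Z ^+ 2 <= B * r ^+ 2.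
  rewrite -ler_pdivrMr ?exprn_gt0//; apply: le_trans tB.
  rewrite mulr_sumr mulr_suml; apply: ler_sum => -[i /= _] _; rewrite -/(x i%:Z).
  have -> : `|x i%:Z| / 2 = (r / 2) * (`|x i%:Z| / r) by field; rewrite gt_eqF.
  rewrite (@powRM _ (r / 2)) ?divr_ge0 ?(ltW r0)// [leRHS]mulrCA -mulrA -[_ * _ / r ^+ 2]mulrA.
  rewrite ler_wpM2l ?powR_ge0//.
  rewrite ler_wpM2l ?(ltW (alpha_gt0 _))//.
  have -> : x i%:Z ^+ 2 / r ^+ 2 = (`|x i%:Z| / r) ^+ 2.
    by rewrite expr_div_n real_normK ?num_real.
  have : 0 <= `|x i%:Z| / r by rewrite divr_ge0// ltW.
  rewrite le_eqVlt => /predU1P[<-|t0]; first by rewrite expr0n /= powR_ge0.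
  rewrite -powR_mulrn ?(ltW t0)// ger_powR ?t0 ?ler_pdivrMr ?mul1r ?xr//.
  by rewrite (le_trans (ltW p1))// ler1n.
(* For the moment matrix [M] and [v = (a, b)], the Cayley-Hamilton theorem gives [|M v| ^ 2 = tr M *
   <v, M v> - det M * |v| ^ 2]; the two squares used below are the squared coordinates of [M v]. *)
have Q : D * r ^+ 2 <= (M11 + M22) * \sum_(i < N) alpha i%:Z * x i%:Z ^+ 2.
  have -> : \sum_(i < N) alpha i%:Z * x i%:Z ^+ 2 =
      a ^+ 2 * M11 + 2 * a * b * M12 + b ^+ 2 * M22.
    rewrite /M11 /M12 /M22 !mulr_sumr -!big_split; apply: eq_bigr => i _ /=.
    by rewrite /x; ring.
  apply: (le_trans (ler_wpM2r (sqr_ge0 r) DM)).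
  rewrite r2; have := sqr_ge0 (a * M11 + b * M12); have := sqr_ge0 (a * M12 + b * M22).
  lra.
have K : (r / 2) `^ p * D <= (M11 + M22) * B.
  rewrite -(ler_pM2r (exprn_gt0 2 r0)) -mulrA.
  apply: (le_trans (ler_wpM2l (powR_ge0 _ _) Q)).
  by rewrite mulrCA -mulrA ler_wpM2l.
rewrite -ler_pdivlMr// in K.
rewrite -ler_pdivrMl// mulrC.
have -> : r / 2 = ((r / 2) `^ p) `^ p^-1.
  by rewrite -powRrM mulfV ?gt_eqF// powRr1// divr_ge0// ltW.
rewrite ge0_ler_powR ?nnegrE ?powR_ge0 ?invr_ge0 ?(ltW p0)//.
by rewrite (le_trans _ K)// powR_ge0.
Qed.

End DiscreteBounds.

(** * Riemann sums *)

Section Partition.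
Context d (T : measurableType d) (R : realType) (mu : {measure set T -> \bar R}).
Variables (X g w : T -> R) (a : nat -> R).
Hypotheses (mX : measurable_fun setT X) (a_nd : {homo a : i j / (i <= j)%N >-> i <= j}).

Let cell (k n : nat) : set T := X @^-1` `[a k, a n[.

Lemma measurable_preimage_itv (i : interval R) : measurable (X @^-1` [set` i]).
Proof. by rewrite -[X in measurable X]setTI; apply: mX => //; exact: measurable_itv. Qed.

Lemma cellS n : cell 0 n.+1 = cell 0 n `|` cell n n.+1.
Proof.
apply/seteqP; split=> x /=; rewrite /cell /= !in_itv /=.
  by move=> /andP[-> ->]; case: (ltP (X x) (a n)); [left|right].
move=> [/andP[-> /lt_le_trans]|/andP[+ ->]]; first by apply; exact: a_nd.
by rewrite andbT; apply: le_trans; exact: a_nd.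
Qed.

Lemma Rintegral_cellS (F : T -> R) n : mu.-integrable (cell 0 n.+1) (EFin \o F) ->
  \int[mu]_(x in cell 0 n.+1) F x =
  \int[mu]_(x in cell 0 n) F x + \int[mu]_(x in cell n n.+1) F x.
Proof.
rewrite cellS => iF; rewrite Rintegral_setU//; try exact: measurable_preimage_itv.
apply/disj_set2P/seteqP; split=> x //= []; rewrite /cell /= !in_itv /=.
by move=> /andP[_ h] /andP[]; rewrite leNgt h.
Qed.

Lemma sum_Rintegral_cells n : mu.-integrable (cell 0 n) (EFin \o w) ->
  \sum_(k < n) \int[mu]_(x in cell k k.+1) w x = \int[mu]_(x in cell 0 n) w x.
Proof.
elim: n => [|n IHn] iw.
  rewrite !big_ord0 (_ : cell 0 0 = set0) ?Rintegral_set0//.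
  by apply/seteqP; split => x //=; rewrite /cell /= in_itv /= => /andP[/le_lt_trans/[apply]]; rewrite ltxx.
have mc k j : measurable (cell k j) by exact: measurable_preimage_itv.
rewrite big_ord_recr /= Rintegral_cellS// IHn//.
by apply: integrableS iw => //; rewrite cellS => x; left.
Qed.

(** The error may vary from cell to cell, so that for a function of a monotone map the errors
    telescope. *)
Lemma partition_Rintegral (c e : nat -> R) n :
  (forall x, 0 <= w x) ->
  mu.-integrable (cell 0 n) (EFin \o w) ->
  mu.-integrable (cell 0 n) (EFin \o (fun x => g x * w x)) ->
  (forall k x, (k < n)%N -> a k <= X x -> X x < a k.+1 -> `|g x - c k| <= e k) ->
  `|\int[mu]_(x in cell 0 n) (g x * w x) -
    \sum_(k < n) c k * \int[mu]_(x in cell k k.+1) w x|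
  <= \sum_(k < n) e k * \int[mu]_(x in cell k k.+1) w x.
Proof.
move=> w0; elim: n => [|n IHn] iw igw ce.
  rewrite !big_ord0 subr0 (_ : cell 0 0 = set0) ?Rintegral_set0 ?normr0//.
  by apply/seteqP; split => x //=; rewrite /cell /= in_itv /= => /andP[/le_lt_trans/[apply]]; rewrite ltxx.
have mc k j : measurable (cell k j) by exact: measurable_preimage_itv.
have sub0 : cell 0 n `<=` cell 0 n.+1 by rewrite cellS => x; left.
have subn : cell n n.+1 `<=` cell 0 n.+1 by rewrite cellS => x; right.
have iwn := integrableS (mc _ _) (mc _ _) subn iw.
have igwn := integrableS (mc _ _) (mc _ _) subn igw.
have icw (k : R) : mu.-integrable (cell n n.+1) (EFin \o (fun x => k * w x)).
  by have := integrableZl (mc _ _) k iwn; apply: eq_integrable.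
rewrite !big_ord_recr /= Rintegral_cellS// opprD addrACA.
rewrite (le_trans (ler_normD _ _))// lerD//.
  apply: IHn; [exact: integrableS iw|exact: integrableS igw|].
  by move=> k x kn; apply: ce; exact: ltnW.
rewrite -RintegralZl// -RintegralB//.
have iB : mu.-integrable (cell n n.+1) (EFin \o (fun x => g x * w x - c n * w x)).
  by have := integrableB (mc _ _) igwn (icw (c n)); apply: eq_integrable.
rewrite (le_trans (le_normr_Rintegral _ iB))// -RintegralZl//.
apply: le_Rintegral => //.
  by have := integrable_norm iB; apply: eq_integrable.
move=> x; rewrite /cell /= in_itv /= => /andP[h1 h2].
by rewrite -mulrBl normrM (ger0_norm (w0 _)) ler_wpM2r// ce.
Qed.

End Partition.

Lemma cvg_step (R : realType) : (pi / m%:R : R) @[m --> \oo] --> 0.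
Proof.
rewrite -(mulr0 pi); apply: cvgMr.
apply: (iffRL (gtr0_cvgV0 _)); last exact: cvgr_idn.
by near=> k; rewrite ltr0n; near: k; exact: nbhs_infty_gt.
Unshelve. all: by end_near. Qed.

Section Riemann.
Context d (T : measurableType d) (R : realType) (mu : {measure set T -> \bar R}).
Variables (X w : T -> R).
Hypotheses (mX : measurable_fun setT X).

Lemma integrable_continuousM (phi : R -> R) (D : set T) (a b : R) : measurable D ->
  continuous phi -> (forall x, D x -> a <= X x <= b) ->
  mu.-integrable D (EFin \o w) ->
  mu.-integrable D (EFin \o (fun x => phi (X x) * w x)).
Proof.
move=> mD cphi DX iw; have [M M0 hM] := continuous_bounded_itv a b cphi.
apply: (@eq_integrable _ _ _ mu D mD ((EFin \o (phi \o X)) \* (EFin \o w))%E) => //.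
apply: integrableMr => //.
- apply: measurable_funTS; apply: measurableT_comp => //.
  exact: continuous_measurable_fun.
- exists M; split; first exact: num_real.
  by move=> z Mz x Dx /=; rewrite (le_trans (hM _ (DX _ Dx)))// ltW.
Qed.

Hypotheses (w_ge0 : forall x, 0 <= w x)
  (iw : mu.-integrable (X @^-1` `[0, pi *+ 2[) (EFin \o w)).

Let mI (i : interval R) : measurable (X @^-1` [set` i]).
Proof. exact: measurable_preimage_itv. Qed.

Lemma riemann_estimate (phi : R -> R) (eps : R) : continuous phi -> 0 < eps ->
  exists2 C : R, 0 <= C & forall m, (0 < m)%N ->
  `|\int[mu]_(x in X @^-1` `[0, pi *+ 2[) (phi (X x) * w x) -
    \sum_(k < m.*2) phi (k%:R * (pi / m%:R)) *
      \int[mu]_(x in X @^-1` `[k%:R * (pi / m%:R), k.+1%:R * (pi / m%:R)[) w x|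
  <= (eps + C * (pi / m%:R)) * \int[mu]_(x in X @^-1` `[0, pi *+ 2[) w x.
Proof.
move=> cphi e0; have [C C0 hC] := uniform_modulus 0 (pi *+ 2) cphi e0.
exists C => // m m0; pose dl : R := pi / m%:R.
have d0 : 0 < dl by exact: step_gt0.
pose a (k : nat) := k%:R * dl.
have a_nd : {homo a : i j / (i <= j)%N >-> i <= j}.
  by move=> i j ij; rewrite ler_wpM2r ?(ltW d0)// ler_nat.
have a0 : a 0 = 0 by rewrite /a mul0r.
have aN : a m.*2 = pi *+ 2 by rewrite /a step_full.
have E : X @^-1` `[0, pi *+ 2[ = X @^-1` `[a 0%N, a m.*2[ by rewrite a0 aN.
have iw' : mu.-integrable (X @^-1` `[a 0%N, a m.*2[) (EFin \o w) by rewrite -E.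
have ipw : mu.-integrable (X @^-1` `[a 0%N, a m.*2[) (EFin \o (fun x => phi (X x) * w x)).
  apply: (@integrable_continuousM phi _ 0 (pi *+ 2)) => // x.
  by rewrite a0 aN /= in_itv /= => /andP[-> /ltW].
rewrite E.
have := @partition_Rintegral _ _ _ mu X (phi \o X) w a mX a_nd
  (phi \o a) (fun=> eps + C * dl) m.*2 w_ge0 iw' ipw.
move=> /(_ _)/le_trans; apply.
  move=> k x km h1 h2 /=.
  have ak : 0 <= a k <= pi *+ 2.
    by rewrite -a0 -aN !a_nd// ltnW.
  have Xk : 0 <= X x <= pi *+ 2.
    have /andP[h _] := ak; rewrite (le_trans h h1)/= (le_trans (ltW h2))//.
    by rewrite -aN a_nd.
  rewrite (le_trans (hC _ _ Xk ak))// lerD2l ler_wpM2l// ger0_norm ?subr_ge0//.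
  by rewrite lerBlDl (le_trans (ltW h2))// /a -addn1 natrD mulrDl mul1r.
rewrite -mulr_sumr ler_wpM2l//.
  by rewrite addr_ge0 ?(ltW e0)// mulr_ge0// ltW.
by rewrite sum_Rintegral_cells.
Qed.

Lemma riemann_cvg (phi : R -> R) : continuous phi ->
  \sum_(k < m.*2) phi (k%:R * (pi / m%:R)) *
      \int[mu]_(x in X @^-1` `[k%:R * (pi / m%:R), k.+1%:R * (pi / m%:R)[) w x
  @[m --> \oo] --> \int[mu]_(x in X @^-1` `[0, pi *+ 2[) (phi (X x) * w x).
Proof.
move=> cphi; apply/cvgrPdist_le => eps e0.
set W := \int[mu]_(x in X @^-1` `[0, pi *+ 2[) w x.
have W0 : 0 <= W by exact: Rintegral_ge0.
have W1 : 0 < W + 1 by rewrite ltr_wpDl.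
have e1 : 0 < eps / (W + 1) / 2 by rewrite !divr_gt0.
have [C C0 hC] := riemann_estimate cphi e1.
have cC : C * (pi / m%:R) @[m --> \oo] --> C * 0 by apply: cvgMr; exact: cvg_step.
rewrite mulr0 in cC.
near=> m.
have m0 : (0 < m)%N by near: m; exact: nbhs_infty_gt.
rewrite (le_trans (hC m m0))// -/W.
have : C * (pi / m%:R) <= eps / (W + 1) / 2 by near: m; apply: cvgr_le cC _ _.
move=> H; apply: (@le_trans _ _ (eps / (W + 1) * W)).
  rewrite ler_wpM2r// [leRHS]splitr lerD//.
by rewrite mulrAC ler_pdivrMr// ler_wpM2l ?lerDl// ltW.
Unshelve. all: by end_near. Qed.

End Riemann.

(** * The polygons associated with [f] *)

Section LebesgueLine.
Variable R : realType.
Let LL := lebesgue_line R.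
Let mu : {measure set LL -> \bar R} := @completed_lebesgue_measure R.

Lemma measurable_lebesgue_line (A : set R) :
  measurable (A : set (measurableTypeR R)) -> measurable (A : set LL).
Proof. exact: sub_caratheodory. Qed.

Lemma measurable_fun_lebesgue_line (D : set R) (g : R -> R) :
  measurable_fun (D : set (measurableTypeR R)) (g : measurableTypeR R -> R) -> 
  measurable (D : set (measurableTypeR R)) ->
  measurable_fun (D : set LL) (g : LL -> R).
Proof. by move=> mg mD _ Y mY; apply: measurable_lebesgue_line; exact: mg. Qed.

Lemma measurable_id_lebesgue_line : measurable_fun [set: LL] (id : LL -> R).
Proof. exact: (@measurable_fun_lebesgue_line setT id). Qed.

Lemma completed_lebesgueE (A : set R) : mu A = lebesgue_measure A.
Proof. by []. Qed.

Lemma negligible_set1_completed (r : R) : mu.-negligible [set r].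
Proof.
exists [set r]; split => //; first exact: measurable_lebesgue_line.
by rewrite completed_lebesgueE lebesgue_measure_set1.
Qed.

Lemma negligible_subset1 (Z : set LL) : (forall s t, Z s -> Z t -> s = t) -> mu.-negligible Z.
Proof.
move=> Zst; have [[z Zz]|Z0] := pselect (Z !=set0).
  by apply: negligibleS (negligible_set1_completed z) => t /(Zst _ _ Zz) ->.
rewrite (_ : Z = set0); first exact: negligible_set0.
by apply/seteqP; split => t // Zt; apply: Z0; exists t.
Qed.

(** Two distinct zeros at distance less than [pi] give a linear system in [(a, b)] whose determinant
    [sin (t - s)] is not 0. Hence a half-open interval of length [pi] contains at most one zero. *)
Lemma wave_zeros_negligible (a b : R) : (a, b) != (0, 0) ->
  mu.-negligible [set t : LL | `[0, pi *+ 2]%classic t /\ a * cos t + b * sin t = 0].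
Proof.
move=> ab0.
have Z c : mu.-negligible [set t : LL | `[c, c + pi[%classic t /\ a * cos t + b * sin t = 0].
  apply: negligible_subset1 => s t.
  wlog st : s t / (s : R) <= t => [H Zs Zt|[Hs xs] [Ht xt]].
    by case: (leP (s : R) t) => [/H|/ltW/H] => [|H']; [exact|apply/esym/H'].
  apply/eqP; apply: contra_neqT ab0 => /= nst.
  have stlt : (s : R) < t by rewrite lt_neqAle nst.
  have : sin (t - s) != 0.
    rewrite gt_eqF// sin_gt0_pi// subr_gt0 stlt/=.
    by move: Hs Ht; rewrite /= !in_itv /= => /andP[h1 h2] /andP[h3 h4]; lra.
  rewrite sinB => D0.
  have : a * (sin t * cos s - cos t * sin s) = 0.
    have -> : a * (sin t * cos s - cos t * sin s) =
       sin t * (a * cos s + b * sin s) - sin s * (a * cos t + b * sin t) by ring.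
    by rewrite xs xt !mulr0 subrr.
  have : b * (sin t * cos s - cos t * sin s) = 0.
    have -> : b * (sin t * cos s - cos t * sin s) =
       cos s * (a * cos t + b * sin t) - cos t * (a * cos s + b * sin s) by ring.
    by rewrite xs xt !mulr0 subrr.
  by move=> /eqP + /eqP; rewrite !mulf_eq0 (negbTE D0) !orbF => /eqP -> /eqP ->.
have Z3 := negligibleU (negligibleU (Z 0) (Z pi)) (negligible_set1_completed (pi *+ 2)).
apply: negligibleS Z3 => t [+ xt]; rewrite /= in_itv /= => /andP[t0 t2].
case: (ltgtP t (pi *+ 2)) t2 => // [t2 _|-> _]; last by right.
case: (ltP t pi) => tpi; left.
  by left; split => //; rewrite /= in_itv /= t0 add0r.
by right; split => //; rewrite /= in_itv /= tpi -mulr2n.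
Qed.

Variables (f : R -> R) (f_ge0 : forall t, 0 <= f t).
Hypotheses (f_meas : lebesgue_measurable_fun f)
  (f_int_gt0 : (0 < \int[mu]_(t in `[0%R, (pi *+ 2)%R]) (f t)%:E)%E)
  (f_int_fin : (\int[mu]_(t in `[0%R, (pi *+ 2)%R]) (f t)%:E < +oo)%E).

Let mf D : measurable_fun D (f : LL -> R).
Proof. exact: measurable_funTS. Qed.

Lemma f_integrable : mu.-integrable `[0, pi *+ 2] (EFin \o f).
Proof.
apply/integrableP; split; first exact/measurable_EFinP.
by under eq_integral do rewrite /= ger0_norm//.
Qed.

Let mitv (i : interval R) : measurable ([set` i] : set LL).
Proof. by apply: measurable_lebesgue_line; exact: measurable_itv. Qed.

Lemma f2_integrable : mu.-integrable `[0, pi *+ 2[ (EFin \o (fun t => 2 * f t)).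
Proof.
have := integrableZl (mitv _) 2 f_integrable.
apply: integrableS => //; exact: subset_itv_co_cc.
Qed.

(** A vanishing integral would force [f = 0] almost everywhere off the zeros of the wave, hence
    almost everywhere. This is the precise sense in which [f] does not concentrate on two antipodal
    directions. *)
Lemma integral_wave2_gt0 (a b : R) : (a, b) != (0, 0) ->
  0 < \int[mu]_(t in `[0, pi *+ 2[) ((a * cos t + b * sin t) ^+ 2 * (2 * f t)).
Proof.
move=> ab0; pose D : set LL := `[0, pi *+ 2[%classic; pose D' : set LL := `[0, pi *+ 2]%classic.
have cw : continuous (fun t : R => (a * cos t + b * sin t) ^+ 2).
  by move=> t; apply: cvgM; (apply: cvgD; apply: cvgMr; [exact: continuous_cos|exact: continuous_sin]).
rewrite lt_neqAle Rintegral_ge0 ?andbT; last first.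
  by move=> t _; rewrite mulr_ge0 ?sqr_ge0 ?mulr_ge0.
apply/eqP => I0.
pose g (t : LL) := (a * cos t + b * sin t) ^+ 2 * (2 * f t).
have ig : mu.-integrable D (EFin \o g).
  apply: (@integrable_continuousM _ LL _ mu id (fun t => 2 * f t) measurable_id_lebesgue_line
    (fun t => (a * cos t + b * sin t) ^+ 2) D 0 (pi *+ 2)).
  - exact: mitv.
  - exact: cw.
  - by move=> t; rewrite /D /= in_itv /= => /andP[-> /ltW].
  - exact: f2_integrable.
have E0 : (\int[mu]_(t in D) ((a * cos t + b * sin t) ^+ 2 * (2 * f t))%:E = 0)%E.
  apply/eqP; rewrite -fine_eq0; first exact/eqP/esym.
  exact: (integrable_fin_num (mitv _) ig).
have /(ae_eq_integral_abs mu (mitv _) (measurable_int mu ig)) H :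
    (\int[mu]_(t in D) `|(EFin \o g) t| = 0)%E.
  rewrite -[RHS]E0; apply: eq_integral => t _ /=.
  by rewrite ger0_norm// mulr_ge0 ?sqr_ge0 ?mulr_ge0.
have : ae_eq mu D' (EFin \o f) (cst 0%E).
  have := negligibleU (negligibleU H (wave_zeros_negligible ab0)) (negligible_set1_completed (pi *+ 2)).
  apply: negligibleS => t /= /not_implyP[D't /eqP ft0].
  have [->|t2] := eqVneq (t : R) (pi *+ 2); first by right.
  left; have [x0|x0] := eqVneq (a * cos t + b * sin t) 0; first by right.
  left; apply/not_implyP; split.
    by move: D't; rewrite /D /D' /= !in_itv /= => /andP[-> t2']; rewrite lt_neqAle t2.
  apply/eqP; rewrite /= eqe /g mulf_eq0 sqrf_eq0 (negbTE x0) /= mulf_eq0 pnatr_eq0 /=.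
  by apply: contra_neq ft0 => /= ->.
move/(ae_eq_integral_abs mu (mitv _) (measurable_int mu f_integrable)).
have -> : (\int[mu]_(x in D') `|(EFin \o f) x| = \int[mu]_(t in D') (f t)%:E)%E.
  by apply: eq_integral => t _ /=; rewrite ger0_norm.
by move=> F0; move: f_int_gt0; rewrite F0 ltxx.
Qed.

End LebesgueLine.

(** * Discretization of the measure with density [2 f] *)

Section Weights.
Variable R : realType.
Let LL := lebesgue_line R.
Let mu : {measure set LL -> \bar R} := @completed_lebesgue_measure R.

Lemma riemann_lebesgue (phi : R -> R) : continuous phi ->
  \sum_(k < m.*2) phi (k%:R * (pi / m%:R)) * (pi / m%:R) @[m --> \oo] -->
    \int[lebesgue_measure]_(t in `[0, pi *+ 2]) phi t.
Proof.
move=> cphi.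
have i1 : (@lebesgue_measure R).-integrable `[0, pi *+ 2[ (EFin \o (fun=> 1)).
  apply: measurable_bounded_integrable => //.
  - by rewrite /= lebesgue_measure_itv; case: ifP => //= _; rewrite -EFinB ltry.
  - by exists 1; split => // z z1 x _ /=; rewrite normr1 ltW.
have iphi : (@lebesgue_measure R).-integrable `[0, pi *+ 2[ (EFin \o phi).
  have := @continuous_compact_integrable R phi `[0, pi *+ 2] (@segment_compact R _ _)
    (continuous_subspaceT cphi).
  by apply: integrableS => //; exact: subset_itv_co_cc.
rewrite -Rintegral_itv_bndo_bndc//.
have := @riemann_cvg _ (measurableTypeR R) R lebesgue_measure id (fun=> 1)
  (@measurable_id _ _ setT) (fun=> ler01) i1 phi cphi.
rewrite preimage_id.
under eq_Rintegral do rewrite mulr1.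
apply: cvg_trans; apply: near_eq_cvg; near=> m.
apply: eq_bigr => k _; congr (_ * _).
rewrite preimage_id Rintegral_cst//= mul1r.
have d0 : (0 : R) < pi / m%:R.
  by rewrite divr_gt0 ?pi_gt0// ltr0n; near: m; exact: nbhs_infty_gt.
rewrite lebesgue_measure_itv /= lte_fin ltr_pM2r// ltr_nat ltnSn -EFinB /=.
by rewrite -mulrBl -natrB// subSnn mul1r.
Unshelve. all: by end_near. Qed.

Variables (f : R -> R) (f_ge0 : forall t, 0 <= f t).
Hypotheses (f_meas : lebesgue_measurable_fun f)
  (f_int_gt0 : (0 < \int[mu]_(t in `[0%R, (pi *+ 2)%R]) (f t)%:E)%E)
  (f_int_fin : (\int[mu]_(t in `[0%R, (pi *+ 2)%R]) (f t)%:E < +oo)%E).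

Definition f_moment (phi : R -> R) := \int[mu]_(t in `[0, pi *+ 2[) (phi t * (2 * f t)).

(* The summand [(pi / m) ^ 2] only makes the weights positive. *)
Definition weight (m : nat) (i : int) : R :=
  let k := (i %% m.*2%:Z)%Z in let d := pi / m%:R in
  \int[mu]_(t in `[k%:~R * d, (k + 1)%:~R * d[) (2 * f t) + d ^+ 2.

Lemma weight_periodic m : int_periodic m.*2 (weight m).
Proof. by move=> i; rewrite /weight modzDr. Qed.

Lemma weight_gt0 m i : (0 < m)%N -> 0 < weight m i.
Proof.
move=> m0; rewrite /weight ltr_wpDl ?exprn_gt0 ?step_gt0//.
by apply: Rintegral_ge0 => t _; rewrite mulr_ge0.
Qed.

Lemma weight_cvg (phi : R -> R) : continuous phi ->
  \sum_(i < m.*2) weight m i%:Z * phi (i%:Z%:~R * (pi / m%:R)) @[m --> \oo] -->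
    f_moment phi.
Proof.
move=> cphi.
have c1 := @riemann_cvg _ LL R mu id (fun t => 2 * f t) (@measurable_id_lebesgue_line R)
  (fun t => mulr_ge0 (ler0n _ 2) (f_ge0 t)) (f2_integrable f_ge0 f_meas f_int_fin) phi cphi.
have c2 : (pi / m%:R) * \sum_(k < m.*2) phi (k%:R * (pi / m%:R)) * (pi / m%:R)
    @[m --> \oo] --> 0 * \int[lebesgue_measure]_(t in `[0, pi *+ 2]) phi t.
  by apply: cvgM; [exact: cvg_step|exact: riemann_lebesgue].
rewrite mul0r in c2.
rewrite /f_moment -[X in _ --> X]addr0; apply: cvg_trans (cvgD c1 c2).
apply: near_eq_cvg; near=> m.
rewrite fctE mulr_sumr -big_split /=; apply: eq_bigr => k _.
have -> : weight m k = \int[mu]_(t in `[k%:R * (pi / m%:R), k.+1%:R * (pi / m%:R)[) (2 * f t)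
    + (pi / m%:R) ^+ 2.
  rewrite /weight modz_small; last by rewrite ltz_nat ltn_ord andbT.
  have e1 : (k%:Z + 1)%:~R = k.+1%:R :> R by rewrite intrD -natr1.
  by rewrite e1.
by rewrite preimage_id -pmulrn; ring.
Unshelve. all: by end_near. Qed.

Lemma f_moment_gt0 (a b : R) : (a, b) != (0, 0) ->
  0 < a ^+ 2 * f_moment (fun t => cos t ^+ 2) + 2 * a * b * f_moment (fun t => cos t * sin t)
   + b ^+ 2 * f_moment (fun t => sin t ^+ 2).
Proof.
move=> ab0; have := integral_wave2_gt0 f_ge0 f_meas f_int_gt0 f_int_fin ab0.
have cc : continuous (fun t : R => cos t ^+ 2) by move=> t; apply: cvgM; exact: continuous_cos.
have cs : continuous (fun t : R => sin t ^+ 2) by move=> t; apply: cvgM; exact: continuous_sin.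
have ccs : continuous (fun t : R => cos t * sin t).
  by move=> t; apply: cvgM; [exact: continuous_cos|exact: continuous_sin].
have cw : continuous (fun t : R => (a * cos t + b * sin t) ^+ 2).
  by move=> t; apply: cvgM; (apply: cvgD; apply: cvgMr; [exact: continuous_cos|exact: continuous_sin]).
suff -> : \int[mu]_(t in `[0, pi *+ 2[) ((a * cos t + b * sin t) ^+ 2 * (2 * f t)) =
    a ^+ 2 * f_moment (fun t => cos t ^+ 2) + 2 * a * b * f_moment (fun t => cos t * sin t)
    + b ^+ 2 * f_moment (fun t => sin t ^+ 2) by [].
(* Linearity of [f_moment] is inherited from the discrete sums, of which both sides are limits. *)
apply: (cvg_unique _ (weight_cvg cw)); first exact: Rhausdorff.
apply: cvg_trans (cvgD (cvgD (cvgMr (weight_cvg cc)) (cvgMr (weight_cvg ccs)))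
  (cvgMr (weight_cvg cs))).
apply: near_eq_cvg; near=> m; rewrite !fctE.
by rewrite !mulr_sumr -!big_split /=; apply: eq_bigr => i _; ring.
Unshelve. all: by end_near. Qed.

Variables (p : R) (p0 : 0 < p) (p1 : p < 1).

(** The discrete moments converge to those of [2 f], whose determinant is positive. Half of it
    bounds the discrete determinants from below for large [m]; the total masses are bounded as well,
    so one [rho] serves all [n]. *)
Lemma polygon_sequence : exists (m : nat -> nat) (h : nat -> int -> R) (rho : R),
  [/\ forall n, (4 <= m n)%N,
      m @ \oo --> \oo,
      forall n, int_periodic (m n).*2 (h n) /\
        forall i, 0 < h n i /\ 0 < edge (m n) (h n) i,
      forall n a b, (forall j, a * cos (j%:~R * (pi / (m n)%:R)) +
          b * sin (j%:~R * (pi / (m n)%:R)) <= h n j) -> `|a| <= rho /\ `|b| <= rho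
    & forall phi : R -> R, continuous phi ->
      \sum_(i < (m n).*2) edge (m n) (h n) i%:Z * h n i%:Z `^ (1 - p) *
        phi (i%:Z%:~R * (pi / (m n)%:R)) @[n --> \oo] --> f_moment phi].
Proof.
pose I11 := f_moment (fun t => cos t ^+ 2); pose I22 := f_moment (fun t => sin t ^+ 2).
pose I12 := f_moment (fun t => cos t * sin t).
have cc : continuous (fun t : R => cos t ^+ 2) by move=> t; apply: cvgM; exact: continuous_cos.
have cs : continuous (fun t : R => sin t ^+ 2) by move=> t; apply: cvgM; exact: continuous_sin.
have ccs : continuous (fun t : R => cos t * sin t).
  by move=> t; apply: cvgM; [exact: continuous_cos|exact: continuous_sin].
have I22_gt0 : 0 < I22.
  have := @f_moment_gt0 0 1; rewrite -/I11 -/I12 -/I22 => H.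
  have : 0 < 0 ^+ 2 * I11 + 2 * 0 * 1 * I12 + 1 ^+ 2 * I22.
    by apply: H; apply/eqP => -[/eqP]; rewrite oner_eq0.
  by rewrite expr0n /= mulr0 !mul0r !add0r expr1n mul1r.
have Delta_gt0 : 0 < I11 * I22 - I12 ^+ 2.
  (* At [(I22, - I12)] the quadratic form equals [I22] times the determinant. *)
  have := @f_moment_gt0 I22 (- I12); rewrite -/I11 -/I12 -/I22 => H.
  have : 0 < I22 ^+ 2 * I11 + 2 * I22 * (- I12) * I12 + (- I12) ^+ 2 * I22.
    by apply: H; apply/eqP => -[/eqP]; rewrite (gt_eqF I22_gt0).
  have -> : I22 ^+ 2 * I11 + 2 * I22 * (- I12) * I12 + (- I12) ^+ 2 * I22 =
    I22 * (I11 * I22 - I12 ^+ 2) by ring.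
  by rewrite pmulr_rgt0.
pose D := (I11 * I22 - I12 ^+ 2) / 2.
have D0 : 0 < D by rewrite divr_gt0.
pose s11 m := \sum_(i < m.*2) weight m i%:Z * cos (i%:Z%:~R * (pi / m%:R)) ^+ 2.
pose s22 m := \sum_(i < m.*2) weight m i%:Z * sin (i%:Z%:~R * (pi / m%:R)) ^+ 2.
pose s12 m := \sum_(i < m.*2) weight m i%:Z *
  (cos (i%:Z%:~R * (pi / m%:R)) * sin (i%:Z%:~R * (pi / m%:R))).
have cA : s11 m + s22 m @[m --> \oo] --> I11 + I22.
  by apply: cvgD; [exact: weight_cvg cc|exact: weight_cvg cs].
have cD : s11 m * s22 m - s12 m * s12 m @[m --> \oo] --> I11 * I22 - I12 * I12.
  by apply: cvgB; apply: cvgM; [exact: weight_cvg cc|exact: weight_cvg cs|exact: weight_cvg ccs..].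
have [n0 _ hn0] : \forall m \near \oo,
  D <= s11 m * s22 m - s12 m ^+ 2 /\
  \sum_(i < m.*2) weight m i%:Z <= I11 + I22 + 1.
  near=> m; split.
    near: m; apply: cvgr_ge cD _ _; rewrite -expr2 ltr_pdivrMr//; lra.
  have -> : \sum_(i < m.*2) weight m i%:Z = s11 m + s22 m.
    rewrite -big_split; apply: eq_bigr => i _ /=.
    by rewrite -mulrDr cos2Dsin2 mulr1.
  by near: m; apply: cvgr_le cA _ _; rewrite ltrDl.
pose m n := (n + (n0 + 4))%N.
have m4 n : (4 <= m n)%N by rewrite /m; lia.
have m0 n : (0 < m n)%N by apply: leq_trans (m4 n).
have /choice[h hP] n := discrete_Minkowski (m4 n) p0 p1 (@weight_periodic (m n))
  (fun i => @weight_gt0 (m n) i (m0 n)).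
pose A := I11 + I22 + 1; pose B := 2 * (pi * A ^+ 2 + A / (p / (1 - p))).
exists m, h, (2 * (A * B / D) `^ p^-1).
have shift (F : nat -> R) (l : R) : F k @[k --> \oo] --> l -> F (m n) @[n --> \oo] --> l.
  by move=> Fl; rewrite -(cvg_shiftn (n0 + 4)%N) in Fl.
split => //.
- exact: cvg_addnr.
- by move=> n; have [hN h0 e0 _ _] := hP n.
- move=> n a b ab; have [hN h0 e0 ee hB] := hP n.
  have [hD hA] := hn0 (m n) (leq_trans (leq_addr 4 n0) (leq_addl n _)).
  have w0 i := @weight_gt0 (m n) i (m0 n).
  have S0 : 0 <= \sum_(i < (m n).*2) weight (m n) i%:Z by apply: sumr_ge0 => i _; exact: ltW.
  have q0 : 0 < p / (1 - p) by rewrite divr_gt0// subr_gt0.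
  have hB' : area2 (m n) (h n) <= B.
    apply: (le_trans hB); rewrite ler_wpM2l// lerD//.
      rewrite ler_wpM2l ?pi_ge0// lerXn2r ?nnegrE//; exact: le_trans hA.
    by rewrite ler_wpM2r// invr_ge0 ltW.
  have B0 : 0 <= B.
    apply: le_trans hB'; apply: sumr_ge0 => i _.
    by rewrite mulr_ge0// ltW.
  have [aR bR] := vertex_bound (m4 n) p0 p1 hN h0 ee w0 hB' D0 hD ab.
  have K : 2 * ((s11 (m n) + s22 (m n)) * B / D) `^ p^-1 <= 2 * (A * B / D) `^ p^-1.
    rewrite /s11 /s22 -big_split /=; under eq_bigr do rewrite -mulrDr cos2Dsin2 mulr1.
    have A0 : 0 <= A by apply: le_trans hA.
    rewrite ler_wpM2l// ge0_ler_powR ?nnegrE ?invr_ge0 ?(ltW p0)//.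
    - by apply: divr_ge0; [exact: mulr_ge0|exact: ltW].
    - by apply: divr_ge0; [exact: mulr_ge0|exact: ltW].
    - by rewrite ler_wpM2r ?invr_ge0 ?(ltW D0)// ler_wpM2r.
  by split; exact: le_trans K.
- move=> phi cphi; apply: cvg_trans (shift _ _ (weight_cvg cphi)); apply: near_eq_cvg; near=> n.
  by apply: eq_bigr => i _; have [_ _ _ <- _] := hP n.
Unshelve. all: by end_near. Qed.

End Weights.

(** * Weak compactness of measures *)

Lemma lebesgue_itv_co (R : realType) (a b : R) : a <= b ->
  lebesgue_measure (`[a, b[%classic : set (measurableTypeR R)) = (b - a)%:E.
Proof.
rewrite le_eqVlt => /predU1P[->|ab].
  by rewrite lebesgue_measure_itv /= lte_fin ltxx subrr.
by rewrite lebesgue_measure_itv /= lte_fin ab -EFinB.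
Qed.

Lemma bounded_integrable_co (R : realType) (g : R -> R) (a b M : R) : a <= b ->
  measurable_fun setT g -> (forall x, `|g x| <= M) ->
  lebesgue_measure.-integrable `[a, b[ (EFin \o g).
Proof.
move=> ab mg gM; apply: measurable_bounded_integrable => //.
- by rewrite [ltLHS]lebesgue_itv_co// ltry.
- exact: measurable_funTS.
- by exists M; split; [exact: num_real|move=> z /ltW Mz x _ /=; exact: le_trans Mz].
Qed.

Lemma partition_lebesgue (R : realType) (g : R -> R) (M : R) (a c e : nat -> R) n :
  measurable_fun setT g -> (forall x, `|g x| <= M) ->
  {homo a : i j / (i <= j)%N >-> i <= j} ->
  (forall k x, (k < n)%N -> a k <= x -> x < a k.+1 -> `|g x - c k| <= e k) ->
  `|\int[lebesgue_measure]_(x in `[a 0%N, a n[) g x -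
    \sum_(k < n) c k * (a k.+1 - a k)| <= \sum_(k < n) e k * (a k.+1 - a k).
Proof.
move=> mg gM a_nd ge.
have i1 : lebesgue_measure.-integrable `[a 0%N, a n[ (EFin \o (fun=> 1)).
  by apply: (@bounded_integrable_co _ (fun=> 1) _ _ 1) => [|//|x]; rewrite ?normr1// a_nd.
have ig : lebesgue_measure.-integrable `[a 0%N, a n[ (EFin \o (fun x => g x * 1)).
  have := @bounded_integrable_co _ g (a 0%N) (a n) M (a_nd _ _ (leq0n n)) mg gM.
  by apply: eq_integrable => // x _ /=; rewrite mulr1.
have H k : \int[lebesgue_measure]_(x in `[a k, a k.+1[) (1 : R) = a k.+1 - a k.
  by rewrite Rintegral_cst// mul1r [X in fine X]lebesgue_itv_co ?a_nd.
have := @partition_Rintegral _ (measurableTypeR R) R lebesgue_measure id g (fun=> 1) a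
  (@measurable_id _ _ setT) a_nd c e n (fun=> ler01) i1 ig ge.
rewrite preimage_id.
under eq_Rintegral do rewrite mulr1.
under eq_bigr do rewrite preimage_id H.
by under [leRHS]eq_bigr do rewrite preimage_id H.
Qed.

Section Quantiles.
Variables (R : realType) (c : R) (c0 : 0 < c).

(** The variations of [Q] over the cells telescope to at most [c], so [K] sample points control the
    integral with an error independent of [Q]. Pointwise convergence of monotone functions along an
    ultrafilter is then enough to pass to the limit in the integrals. *)
Lemma nondecreasing_cells (Q phi : R -> R) (eps C : R) (K : nat) :
  {homo Q : s t / s <= t} -> (forall s, 0 <= Q s <= c) -> continuous phi -> (0 < K)%N ->
  0 <= C -> (forall x y, 0 <= x <= c -> 0 <= y <= c -> `|phi x - phi y| <= eps + C * `|x - y|) ->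
  `|\int[lebesgue_measure]_(s in `[0, 1[) phi (Q s) -
     \sum_(k < K) phi (Q (k%:R / K%:R)) / K%:R| <= eps + C * c / K%:R.
Proof.
move=> Q_nd Qc cphi K0 C0 hC; have [M M0 hM] := continuous_bounded_itv 0 c cphi.
pose a (k : nat) : R := k%:R / K%:R.
have Kr0 : (0 : R) < K%:R by rewrite ltr0n.
have a_nd : {homo a : i j / (i <= j)%N >-> i <= j}.
  by move=> i j ij; rewrite ler_wpM2r ?invr_ge0 ?ler_nat// ltW.
have aS k : a k.+1 - a k = K%:R^-1 by rewrite /a -mulrBl -natrB// subSnn mul1r.
have mQ : measurable_fun setT (phi \o Q).
  apply: measurableT_comp; first exact: continuous_measurable_fun.
  exact: nondecreasing_measurable.
have := @partition_lebesgue R (phi \o Q) M a (phi \o Q \o a)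
  (fun k => eps + C * (Q (a k.+1) - Q (a k))) K mQ (fun x => hM _ (Qc x)) a_nd.
have -> : a 0%N = 0 by rewrite /a mul0r.
have -> : a K = 1 by rewrite /a divff// gt_eqF.
under eq_bigr do rewrite aS; under [leRHS]eq_bigr do rewrite aS.
move=> /(_ _)/le_trans; apply.
  move=> k x kK ax xa /=; rewrite (le_trans (hC _ _ (Qc _) (Qc _)))// lerD2l ler_wpM2l//.
  by rewrite ger0_norm ?subr_ge0 ?Q_nd// lerD2r Q_nd// ltW.
rewrite -mulr_suml big_split /= sumr_const card_ord -mulr_sumr.
rewrite -[eps *+ K]mulr_natr mulrDl mulfK ?gt_eqF// lerD2l.
rewrite ler_wpM2r ?invr_ge0 ?(ltW Kr0)// ler_wpM2l//.
have -> : \sum_(k < K) (Q (a k.+1) - Q (a k)) = Q (a K) - Q (a 0%N).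
  by rewrite -(telescope_sumr (fun k => Q (a k)) (leq0n K)) big_mkord.
have /andP[_ h1] := Qc (a K); have /andP[h2 _] := Qc (a 0%N); lra.
Qed.

(** The function [Q] is the quantile function of the probability with masses [e k] at the points
    [x k]. *)
Lemma step_quantile (N : nat) (e x : nat -> R) : (forall k, 0 <= e k) ->
  \sum_(k < N) e k = 1 -> {homo x : i j / (i <= j)%N >-> i <= j} ->
  (forall k, (k <= N)%N -> 0 <= x k <= c) ->
  exists Q : R -> R, [/\ {homo Q : s t / s <= t}, forall s, 0 <= Q s <= c &
    forall phi : R -> R, continuous phi ->
      \int[lebesgue_measure]_(s in `[0, 1[) phi (Q s) = \sum_(k < N) phi (x k) * e k].
Proof.
move=> e0 e1 x_nd xc.
pose cum k := \sum_(j < k) e j.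
have cum_nd : {homo cum : i j / (i <= j)%N >-> i <= j}.
  apply: (homo_leq (r := fun a b : R => a <= b)) => [//|????|k]; first exact: le_trans.
  by rewrite /cum big_ord_recr /= lerDl.
(* The generalized inverse of the cumulated masses, written as a count: it is monotone by
   construction and equals [k] on [[cum k, cum k.+1[], which may be empty. *)
pose cnt (s : R) : nat := (\sum_(i < N) (cum i.+1 <= s)%R)%N.
have cntN s : (cnt s <= N)%N.
  by rewrite -[leqRHS]card_ord -sum1_card; apply: leq_sum => i _; exact: leq_b1.
have cnt_nd s t : s <= t -> (cnt s <= cnt t)%N.
  by move=> st; apply: leq_sum => i _; case: (leP (cum i.+1) s) => // /le_trans/(_ st) ->.
have cntE k s : (k < N)%N -> cum k <= s -> s < cum k.+1 -> cnt s = k.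
  move=> kN ks sk; rewrite /cnt (eq_bigr (fun i : 'I_N => (i < k)%N : nat)); last first.
    move=> i _; congr (nat_of_bool _); case: (ltnP i k) => ik.
      by rewrite (le_trans _ ks)// cum_nd.
    by apply/negbTE; rewrite -ltNge (lt_le_trans sk)// cum_nd.
  have : forall M, (\sum_(i < M) (i < k)%N)%N = minn M k.
    elim=> [|M IHM]; first by rewrite big_ord0 min0n.
    rewrite big_ord_recr /= IHM; case: (ltnP M k) => Mk; lia.
  by move=> ->; apply/minn_idPr; exact: ltnW.
have Q_nd : {homo (x \o cnt) : s t / s <= t} by move=> s t st; exact/x_nd/cnt_nd.
exists (x \o cnt); split => //; first by move=> s; exact: xc.
move=> phi cphi; have [M M0 hM] := continuous_bounded_itv 0 c cphi.
have a0 : cum 0%N = 0 by rewrite /cum big_ord0.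
have mQ : measurable_fun setT (phi \o (x \o cnt)).
  apply: measurableT_comp; first exact: continuous_measurable_fun.
  exact: nondecreasing_measurable.
have E k s : (k < N)%N -> cum k <= s -> s < cum k.+1 ->
    `|(phi \o (x \o cnt)) s - (phi \o x) k| <= 0.
  by move=> kN ks sk /=; rewrite (cntE k)// subrr normr0.
have aN : cum N = 1 by [].
have := @partition_lebesgue R (phi \o (x \o cnt)) M cum (phi \o x) (fun=> 0) N mQ
  (fun s => hM _ (xc _ (cntN s))) cum_nd E.
rewrite a0 aN [leRHS]big1; last by move=> k _; rewrite mul0r.
rewrite normr_le0 subr_eq0 => /eqP ->.
by apply: eq_bigr => k _; rewrite /cum big_ord_recr /= addrAC subrr add0r.
Qed.

End Quantiles.

Section QuantileMeasure.
Variables (R : realType) (c : R) (c0 : 0 < c).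

Lemma quantile_measure (X : R -> R) (P : R) : 0 <= P -> measurable_fun [set: measurableTypeR R] (X : measurableTypeR R -> measurableTypeR R) ->
  (forall s, 0 <= X s < c) ->
  exists mu : {finite_measure set (measurableTypeR R) -> \bar R},
    mu (~` `[0, c[) = 0%E /\
    forall phi : R -> R, continuous phi ->
    \int[mu]_(t in `[0, c[) phi t = P * \int[lebesgue_measure]_(s in `[0, 1[) phi (X s).
Proof.
move=> P0 mX Xc.
pose X' : {mfun measurableTypeR R >-> measurableTypeR R} :=
  HB.pack X (isMeasurableFun.Build _ _ _ _ _ mX).
pose nu := distribution (uniform_prob (@ltr01 R)) X'.
pose mu : {finite_measure set (measurableTypeR R) -> \bar R} := mscale (NngNum P0) nu.
have XD : (X : measurableTypeR R -> measurableTypeR R) @^-1`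
    (`[0, c[%classic : set (measurableTypeR R)) = setT.
  by apply/seteqP; split => // s _; rewrite /= in_itv /= Xc.
have mphiX (phi : R -> R) : continuous phi -> measurable_fun [set: measurableTypeR R] (phi \o X).
  by move=> cphi; apply: (measurableT_comp (continuous_measurable_fun cphi)).
have iX (phi : R -> R) : continuous phi ->
    lebesgue_measure.-integrable `[0, 1[ (EFin \o (phi \o X)).
  move=> cphi; have [M M0 hM] := continuous_bounded_itv 0 c cphi.
  apply: (@bounded_integrable_co _ (phi \o X) 0 1 M) => //; first exact: mphiX.
  by move=> s /=; apply: hM; have /andP[-> /ltW] := Xc s.
have imu (phi : R -> R) : continuous phi -> mu.-integrable `[0, c[ (EFin \o phi).
  move=> cphi; have [M M0 hM] := continuous_bounded_itv 0 c cphi.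
  apply: measurable_bounded_integrable.
  - exact: measurable_itv.
  - by rewrite -ge0_fin_numE ?measure_ge0//; apply: fin_num_measure; exact: measurable_itv.
  - by apply: measurable_funTS; exact: continuous_measurable_fun.
  exists M; split; first exact: num_real.
  move=> z Mz x /=; rewrite in_itv /= => /andP[x0 xc].
  by rewrite (le_trans (hM x _))// ?x0 ?(ltW xc)// ltW.
exists mu; split.
  have -> : mu (~` `[0, c[) = (P%:E * uniform_prob (@ltr01 R)
    (~` ((X : measurableTypeR R -> measurableTypeR R) @^-1` `[0%R, c[%classic)))%E by [].
  by rewrite XD setCT measure0 mule0.
have nneg (phi : R -> R) : continuous phi -> (forall t, 0 <= phi t) ->
    \int[mu]_(t in `[0, c[) phi t = P * \int[lebesgue_measure]_(s in `[0, 1[) phi (X s).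
  move=> cphi phi0; rewrite Rintegral_itv_bndo_bndc; last exact: iX.
  rewrite /Rintegral ge0_integral_mscale//=.
  - rewrite ge0_integral_pushforward//=.
    + rewrite XD integral_uniform//=.
      * rewrite subr0 invr1 mul1e fineM//.
        have : (\int[lebesgue_measure]_(x in `[0%R, 1%R[) (EFin \o (phi \o X)) x \is a fin_num)%E.
          by apply: integrable_fin_num (iX _ cphi); exact: measurable_itv.
        rewrite integral_itv_bndo_bndc//.
        apply: measurable_funTS; apply/measurable_EFinP; exact: mphiX.
      * by apply/measurable_EFinP; exact: mphiX.
      * by move=> s; rewrite lee_fin phi0.
    + by apply: measurable_funTS; apply/measurable_EFinP; exact: continuous_measurable_fun.
    + by move=> s _; rewrite lee_fin phi0.
  - by apply: measurable_funTS; apply/measurable_EFinP; exact: continuous_measurable_fun.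
  - by move=> t _; rewrite lee_fin phi0.
move=> phi cphi; have [M M0 hM] := continuous_bounded_itv 0 c cphi.
(* The change of variables above is for nonnegative functions. On [[0, c]] the function [phi + M] is
   nonnegative, and the absolute value makes it so on the whole line. *)
pose psi t := `|phi t + M|.
have cpsi : continuous psi.
  by move=> t; apply: cvg_norm; apply: cvgD; [exact: cphi|exact: cvg_cst].
have psiE t : 0 <= t <= c -> psi t = phi t + M.
  by move=> /hM; rewrite ler_norml => /andP[h _]; rewrite /psi ger0_norm//; lra.
have cM : continuous (fun _ : R => M) by move=> ?; exact: cvg_cst.
have -> : \int[mu]_(t in `[0, c[) phi t =
    \int[mu]_(t in `[0, c[) psi t - \int[mu]_(t in `[0, c[) M.
  rewrite -RintegralB//; [|exact: imu|exact: imu]; apply: eq_Rintegral => t.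
  by rewrite inE /= in_itv /= => /andP[t0 tc]; rewrite psiE ?addrK// t0 ltW.
have -> : \int[lebesgue_measure]_(s in `[0, 1[) phi (X s) =
    \int[lebesgue_measure]_(s in `[0, 1[) psi (X s) - \int[lebesgue_measure]_(s in `[0, 1[) M.
  rewrite -RintegralB//; [|exact: (iX psi)|exact: (iX (fun=> M))]; apply: eq_Rintegral => s _.
  by have /andP[t0 tc] := Xc s; rewrite psiE ?addrK// t0 ltW.
rewrite mulrBr -(nneg (fun=> M))// -nneg// => t.
exact: normr_ge0.
Qed.

(** Helly's selection theorem for quantile functions: monotone with values in [[0, c]], they
    converge pointwise along [U] to a monotone function. They describe only the normalized measures,
    so the total masses [P n] converge separately. *)
Lemma weak_compactness (U : set_system nat) (UU : UltraFilter U)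
    (N : nat -> nat) (e x : nat -> nat -> R) (B : R) :
  (forall n k, 0 <= e n k) -> (forall n, 0 < \sum_(k < N n) e n k) ->
  (forall n, \sum_(k < N n) e n k <= B) ->
  (forall n, {homo x n : i j / (i <= j)%N >-> i <= j}) ->
  (forall n k, (k <= N n)%N -> 0 <= x n k <= c) ->
  exists mu : {finite_measure set (measurableTypeR R) -> \bar R},
    mu (~` `[0, c[) = 0%E /\
    forall phi : R -> R, continuous phi -> phi c = phi 0 ->
    \sum_(k < N n) e n k * phi (x n k) @[n --> U] --> \int[mu]_(t in `[0, c[) phi t.
Proof.
move=> e0 P_gt0 PB x_nd xc.
have UF : ProperFilter U by exact: ultra_proper.
pose P n := \sum_(k < N n) e n k.
have [Pl PlE] : exists l : R, P n @[n --> U] --> l.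
  apply: (@ultra_bounded_cvg R U UU _ B); apply: nearW => n.
  by rewrite ger0_norm ?PB// ltW// P_gt0.
have Pl0 : 0 <= Pl by apply: (cvgr_to_ge PlE); apply: nearW => n; exact/ltW/P_gt0.
have /choice[Q QP] : forall n, exists Q : R -> R, [/\ {homo Q : s t / s <= t},
    forall s, 0 <= Q s <= c & forall phi : R -> R, continuous phi ->
      \int[lebesgue_measure]_(s in `[0, 1[) phi (Q s) = \sum_(k < N n) phi (x n k) * (e n k / P n)].
  move=> n; apply: (@step_quantile R c c0 (N n) (fun k => e n k / P n) (x n)) => //.
  - by move=> k; rewrite divr_ge0// ltW// P_gt0.
  - by rewrite -mulr_suml divff// gt_eqF// P_gt0.
  - exact: xc.
have /choice[Ql QlE] : forall s, exists l : R, Q n s @[n --> U] --> l.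
  move=> s; apply: (@ultra_bounded_cvg R U UU _ c); apply: nearW => n.
  by have [_ /(_ s)/andP[h1 h2] _] := QP n; rewrite ger0_norm.
have Ql_nd : {homo Ql : s t / s <= t}.
  move=> s t st; apply: ler_cvg_to (QlE s) (QlE t) _.
  by apply: nearW => n; have [h _ _] := QP n; exact: h.
have Qlc s : 0 <= Ql s <= c.
  apply/andP; split; [apply: (cvgr_to_ge (QlE s))|apply: (cvgr_to_le (QlE s))].
    by apply: nearW => n; have [_ /(_ s)/andP[]] := QP n.
  by apply: nearW => n; have [_ /(_ s)/andP[]] := QP n.
(* The limit may put mass at [c], outside the fundamental domain. It is moved to 0, the same point
   of the circle, which functions with [phi c = phi 0] cannot distinguish. *)
pose X s := if Ql s < c then Ql s else 0.
have Xc s : 0 <= X s < c.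
  by rewrite /X; case: ifPn => [->|_]; [rewrite andbT; case/andP: (Qlc s)|rewrite lexx c0].
have mX : measurable_fun [set: measurableTypeR R] (X : measurableTypeR R -> measurableTypeR R).
  have mQ : measurable_fun [set: measurableTypeR R] Ql by exact: nondecreasing_measurable.
  by apply: measurable_fun_ifT => //; exact: measurable_fun_ltr.
have [mu [mu0 muE]] := quantile_measure Pl0 mX Xc.
exists mu; split => // phi cphi phic; rewrite muE//.
have -> : \int[lebesgue_measure]_(s in `[0, 1[) phi (X s) =
    \int[lebesgue_measure]_(s in `[0, 1[) phi (Ql s).
  apply: eq_Rintegral => s _; rewrite /X; case: (ltP (Ql s) c) => // cQ.
  by have /andP[_ Qc] := Qlc s; rewrite -phic; congr phi; apply: le_anti; rewrite cQ Qc.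
have -> : (fun n => \sum_(k < N n) e n k * phi (x n k)) =
    (fun n => P n * \int[lebesgue_measure]_(s in `[0, 1[) phi (Q n s)).
  apply/funext => n; have [_ _ ->//] := QP n; rewrite mulr_sumr.
  by apply: eq_bigr => k _; field; rewrite gt_eqF// P_gt0.
apply: cvgM => //; apply/cvgrPdist_le => eps eps0.
(* Five errors: a modulus and a mesh term for each of [Q n] and [Ql], and the convergence at the
   sample points. *)
have e1 : 0 < eps / 5 by rewrite divr_gt0.
have [C C0 hC] := uniform_modulus 0 c cphi e1.
have [K K0 CK] : exists2 K, (0 < K)%N & C * c / K%:R <= eps / 5.
  exists (Num.truncn (C * c / (eps / 5))).+1 => //.
  rewrite ler_pdivrMr// -ler_pdivrMl// [leLHS]mulrC; apply: ltW; exact: truncnS_gt.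
have cS : \sum_(k < K) phi (Q n (k%:R / K%:R)) / K%:R @[n --> U] -->
    \sum_(k < K) phi (Ql (k%:R / K%:R)) / K%:R.
  apply: (@cvg_big _ _ +%R) => //; first exact: add_continuous.
  by move=> k _; apply: cvgMl; apply: cvg_comp (QlE _) (cphi _).
near=> n.
have [Q_nd Qc _] := QP n.
have h1 := nondecreasing_cells Q_nd Qc cphi K0 C0 hC.
have h2 := nondecreasing_cells Ql_nd Qlc cphi K0 C0 hC.
have h3 : `|\sum_(k < K) phi (Ql (k%:R / K%:R)) / K%:R -
    \sum_(k < K) phi (Q n (k%:R / K%:R)) / K%:R| <= eps / 5.
  by near: n; move/cvgrPdist_le : cS; apply.
move: h1 h2 h3; set I1 := Rintegral _ _ _; set I2 := Rintegral _ _ _.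
set S1 := \sum_(k < K) _; set S2 := \sum_(k < K) _.
rewrite !ler_norml => /andP[h1 h1'] /andP[h2 h2'] /andP[h3 h3'].
by apply/andP; split; lra.
Unshelve. all: by end_near. Qed.

End QuantileMeasure.

(** * The limit of the polygons *)

Unset Implicit Arguments.
Section PolygonLimit.
Variables (R : realType) (p : R) (p0 : 0 < p) (p1 : p < 1).
Variables (m : nat -> nat) (h : nat -> int -> R) (rho : R) (F : (R -> R) -> R).
Hypotheses (m4 : forall n, (4 <= m n)%N) (m_oo : m @ \oo --> \oo)
  (hP : forall n, int_periodic (m n).*2 (h n) /\
    forall i, 0 < h n i /\ 0 < edge (m n) (h n) i)
  (h_vertex : forall n a b, (forall j, a * cos (j%:~R * (pi / (m n)%:R)) +
    b * sin (j%:~R * (pi / (m n)%:R)) <= h n j) -> `|a| <= rho /\ `|b| <= rho)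
  (hF : forall phi : R -> R, continuous phi ->
    \sum_(i < (m n).*2) edge (m n) (h n) i%:Z * h n i%:Z `^ (1 - p) *
      phi (i%:Z%:~R * (pi / (m n)%:R)) @[n --> \oo] --> F phi)
  (F_gt0 : forall a b : R, (a, b) != (0, 0) ->
    0 < a ^+ 2 * F (fun t => cos t ^+ 2) + 2 * a * b * F (fun t => cos t * sin t)
      + b ^+ 2 * F (fun t => sin t ^+ 2)).
Context (U : set_system nat) {UU : UltraFilter U}.
Hypothesis oU : \oo `<=` U.

Let N n := (m n).*2.
Let dl n : R := pi / (m n)%:R.
Let m0 n : (0 < m n)%N. Proof. exact: leq_trans (m4 n). Qed.
Let dl0 n : 0 < dl n. Proof. exact: step_gt0. Qed.
Let hN n : int_periodic (N n) (h n). Proof. by case: (hP n). Qed.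
Let h0 n i : 0 < h n i. Proof. by have [_ /(_ i)[]] := hP n. Qed.
Let e0 n i : 0 < edge (m n) (h n) i. Proof. by have [_ /(_ i)[]] := hP n. Qed.

Lemma step_cvg0 : dl n @[n --> U] --> 0.
Proof. by apply: cvg_trans (cvg_comp _ _ m_oo (@cvg_step R)); exact: cvg_app. Qed.

Lemma polygon_vertex n i : exists a b,
  [/\ forall j, a * cos (j%:~R * dl n) + b * sin (j%:~R * dl n) <= h n j,
      a * cos (i%:~R * dl n) + b * sin (i%:~R * dl n) = h n i,
      `|a| <= rho & `|b| <= rho].
Proof.
have [a [b [ab abi _]]] := normalize_translation (m4 n) i (hN n) (e0 n).
by exists a, b; have [? ?] := h_vertex _ _ _ ab.
Qed.

Let rho0 : 0 <= rho.
Proof. by have [a [b [_ _ /(le_trans (normr_ge0 _))]]] := polygon_vertex 0%N 0. Qed.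

Lemma polygon_le n i : h n i <= 2 * rho.
Proof.
have [a [b [_ <- ar br]]] := polygon_vertex n i.
rewrite (le_trans (ler_norm _))// (le_trans (ler_normD _ _))// !normrM.
have -> : 2 * rho = rho + rho by ring.
rewrite lerD//.
  by rewrite -[leRHS]mulr1 ler_pM// cos_max.
by rewrite -[leRHS]mulr1 ler_pM// sin_max.
Qed.

(** A vertex realizing one support number satisfies the support inequality at every other index, so
    the bound on the vertices acts as a Lipschitz constant. *)
Lemma polygon_lipschitz n i j :
  `|h n i - h n j| <= 2 * rho * `|i%:~R * dl n - j%:~R * dl n|.
Proof.
have H k l : h n k - h n l <= 2 * rho * `|k%:~R * dl n - l%:~R * dl n|.
  have [a [b [ab <- ar br]]] := polygon_vertex n k.
  have := ab l; set x := k%:~R * dl n; set y := l%:~R * dl n => abl.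
  have : a * (cos x - cos y) + b * (sin x - sin y) <= 2 * rho * `|x - y|.
    rewrite (le_trans (ler_norm _))// (le_trans (ler_normD _ _))// !normrM.
    have -> : 2 * rho * `|x - y| = rho * `|x - y| + rho * `|x - y| by ring.
    by rewrite lerD// ler_pM// ?cos_lipschitz ?sin_lipschitz.
  lra.
by rewrite ler_norml H andbT; have := H j i; rewrite distrC; lra.
Qed.

Definition angle_index n (t : R) : int := Num.floor (t / dl n).

Lemma angle_indexP n t : (angle_index n t)%:~R * dl n <= t /\
  t < (angle_index n t)%:~R * dl n + dl n.
Proof.
have /andP := floor_itv (t / dl n); rewrite -/(angle_index n t).
by rewrite ler_pdivlMr// ltr_pdivrMr// intrD mulrDl mul1r.
Qed.

Lemma angle_index_shift n t (k : int) :
  angle_index n (t + k%:~R * dl n) = angle_index n t + k.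
Proof.
apply: floor_def; rewrite ler_pdivlMr// ltr_pdivrMr// !intrD !mulrDl mul1r.
have [h1 h2] := angle_indexP n t.
by rewrite lerD2r h1/= addrAC ltrD2r.
Qed.

Lemma angle_index_grid n (k : int) : angle_index n (k%:~R * dl n) = k.
Proof. by rewrite -[k%:~R * _]add0r angle_index_shift /angle_index mul0r floor0 add0r. Qed.

Lemma angle_index_cvg t : (angle_index n t)%:~R * dl n @[n --> U] --> t.
Proof.
apply/cvgrPdist_le => eps eps0; near=> n.
have [h1 h2] := angle_indexP n t.
rewrite ger0_norm ?subr_ge0//.
have : `|0 - dl n| <= eps by near: n; move/cvgrPdist_le : step_cvg0; apply.
rewrite sub0r normrN gtr0_norm//; lra.
Unshelve. all: by end_near. Qed.

Let hh n t := h n (angle_index n t).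

Lemma hh_lipschitz n s t : `|hh n s - hh n t| <= 2 * rho * (`|s - t| + dl n).
Proof.
rewrite (le_trans (polygon_lipschitz _ _ _))// ler_wpM2l ?mulr_ge0//.
have [h1 h2] := angle_indexP n t; have [h3 h4] := angle_indexP n s.
rewrite ler_norml; have := ler_norm (s - t); have := ler_norm (t - s).
by rewrite distrC => h5 h6; apply/andP; split; lra.
Qed.

Lemma limit_exists : exists H : R -> R, forall t, hh n t @[n --> U] --> H t.
Proof.
suff /choice[H ?] : forall t, exists l : R, hh n t @[n --> U] --> l by exists H.
move=> t; apply: (@ultra_bounded_cvg R U UU _ (2 * rho)).
by apply: nearW => n; rewrite /hh gtr0_norm ?polygon_le.
Qed.

Variables (H : R -> R) (HE : forall t, hh n t @[n --> U] --> H t).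

Lemma limit_ge0 t : 0 <= H t.
Proof. by apply: (cvgr_to_ge (HE t)); apply: nearW => n; exact/ltW/h0. Qed.

Lemma limit_shift t : H (t + pi *+ 2) = H t.
Proof.
apply: (cvg_unique _ (HE _) ); first exact: Rhausdorff.
have -> : (fun n => hh n (t + pi *+ 2)) = (fun n => hh n t); last exact: HE.
apply/funext => n; rewrite /hh; have := step_full R (m0 n); rewrite -/(dl n) => <-.
by rewrite pmulrn angle_index_shift hN.
Qed.

Lemma limit_lipschitz s t : `|H s - H t| <= 2 * rho * `|s - t|.
Proof.
have c1 : `|hh n s - hh n t| @[n --> U] --> `|H s - H t|.
  by apply: cvg_norm; apply: cvgB.
have c2 : 2 * rho * (`|s - t| + dl n) @[n --> U] --> 2 * rho * (`|s - t| + 0).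
  by apply: cvgMr; apply: cvgD; [exact: cvg_cst|exact: step_cvg0].
rewrite -[X in 2 * rho * X]addr0; apply: ler_cvg_to c1 c2 _.
by apply: nearW => n; exact: hh_lipschitz.
Qed.

Lemma limit_continuous : continuous H.
Proof.
move=> t; apply/cvgrPdist_le => eps eps0.
have r0 : 0 < 2 * rho + 1 by rewrite ltr_wpDl// mulr_ge0.
have : \forall s \near t, `|t - s| < eps / (2 * rho + 1).
  by apply/nbhs_ballP; exists (eps / (2 * rho + 1)); rewrite //= divr_gt0.
apply: filterS => s ts; rewrite (le_trans (limit_lipschitz _ _))//.
rewrite (@le_trans _ _ ((2 * rho + 1) * `|t - s|))//.
  by rewrite ler_wpM2r// lerDl.
by rewrite mulrC -ler_pdivlMr// ltW.
Qed.

(** The vertices touching at the grid angles just below [t] are bounded and converge along [U];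
    their limit inherits the contact and the support inequalities. Thus [H] is a support function
    although no limit of sets is taken. *)
Lemma limit_support t : exists a b,
  [/\ a * cos t + b * sin t = H t, forall s, a * cos s + b * sin s <= H s,
      `|a| <= rho & `|b| <= rho].
Proof.
have /choice[ab abP] n : exists ab : R * R,
  [/\ forall j, ab.1 * cos (j%:~R * dl n) + ab.2 * sin (j%:~R * dl n) <= h n j,
      ab.1 * cos ((angle_index n t)%:~R * dl n) +
        ab.2 * sin ((angle_index n t)%:~R * dl n) = hh n t,
      `|ab.1| <= rho & `|ab.2| <= rho].
  by have [a [b abP]] := polygon_vertex n (angle_index n t); exists (a, b).
have [a aE] : exists a : R, (ab n).1 @[n --> U] --> a.
  by apply: (@ultra_bounded_cvg R U UU _ rho); apply: nearW => n; have [] := abP n.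
have [b bE] : exists b : R, (ab n).2 @[n --> U] --> b.
  by apply: (@ultra_bounded_cvg R U UU _ rho); apply: nearW => n; have [] := abP n.
have L s : (ab n).1 * cos ((angle_index n s)%:~R * dl n) +
    (ab n).2 * sin ((angle_index n s)%:~R * dl n) @[n --> U] --> a * cos s + b * sin s.
  apply: cvgD; apply: cvgM => //.
    exact: cvg_comp (angle_index_cvg s) (@continuous_cos R s).
  exact: cvg_comp (angle_index_cvg s) (@continuous_sin R s).
exists a, b; split.
- apply: (cvg_unique _ (L t)); first exact: Rhausdorff.
  have -> : (fun n => (ab n).1 * cos ((angle_index n t)%:~R * dl n) +
    (ab n).2 * sin ((angle_index n t)%:~R * dl n)) = (fun n => hh n t); last exact: HE.
  by apply/funext => n; have [_ -> _ _] := abP n.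
- move=> s; apply: ler_cvg_to (L s) (HE s) _.
  by apply: nearW => n; have [+ _ _ _] := abP n; apply.
- apply: (cvgr_to_le (cvg_norm aE)); apply: nearW => n.
  by have [_ _ + _] := abP n.
- apply: (cvgr_to_le (cvg_norm bE)); apply: nearW => n.
  by have [_ _ _] := abP n.
Qed.

(** Finitely many knots suffice, because the functions [hh n] are Lipschitz up to an error
    proportional to [dl n]. *)
Lemma limit_uniform eps : 0 < eps ->
  \forall n \near U, forall i : nat, (i < N n)%N ->
    `|h n i%:Z - H (i%:R * dl n)| <= eps.
Proof.
move=> eps0; have e1 : 0 < eps / 5 by rewrite divr_gt0.
have r0 : 0 <= 2 * rho by rewrite mulr_ge0.
have p2 : (0 : R) < pi *+ 2 by rewrite mulrn_wgt0// pi_gt0.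
pose K := (Num.truncn (2 * rho * (pi *+ 2) / (eps / 5))).+1.
have K0 : (0 : R) < K%:R by rewrite ltr0n.
have CK : 2 * rho * (pi *+ 2 / K%:R) <= eps / 5.
  rewrite mulrA ler_pdivrMr// -ler_pdivrMl// [leLHS]mulrC; apply: ltW; exact: truncnS_gt.
pose tk (k : nat) : R := k%:R * (pi *+ 2 / K%:R).
have knots : \forall n \near U, forall k : 'I_K, `|hh n (tk k) - H (tk k)| <= eps / 5.
  apply: filter_forall => k.
  by have /cvgrPdist_le/(_ _ e1) := HE (tk k); apply: filterS => n; rewrite distrC.
have dlc : \forall n \near U, 2 * rho * dl n <= eps / 5.
  have c : 2 * rho * dl n @[n --> U] --> 2 * rho * 0 by apply: cvgMr; exact: step_cvg0.
  by apply: cvgr_le c _ _; rewrite mulr0.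
near=> n; move=> i iN.
pose t := i%:R * dl n.
have t0 : 0 <= t by rewrite mulr_ge0// ltW.
have t2 : t < pi *+ 2 by rewrite /t -(step_full R (m0 n)) ltr_pM2r// ltr_nat.
have w0 : (0 : R) < pi *+ 2 / K%:R by rewrite divr_gt0.
pose k := Num.truncn (t / (pi *+ 2 / K%:R)).
have /truncn_itv/andP[] : 0 <= t / (pi *+ 2 / K%:R) by rewrite divr_ge0// ltW.
rewrite -/k ler_pdivlMr// ltr_pdivrMr// => k1 k2.
have kK : (k < K)%N.
  rewrite -(ltr_nat R) -(ltr_pM2r w0) (le_lt_trans k1)//.
  by rewrite mulrC divfK// gt_eqF.
have ttk : `|t - tk k| <= pi *+ 2 / K%:R.
  rewrite ger0_norm ?subr_ge0//; move: k2; rewrite /tk -addn1 natrD mulrDl mul1r; lra.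
have -> : h n i%:Z = hh n t by rewrite /hh /t pmulrn angle_index_grid.
have a1 := hh_lipschitz n t (tk k).
have a2 := limit_lipschitz (tk k) t.
have a3 : `|hh n (tk k) - H (tk k)| <= eps / 5.
  by have /(_ (Ordinal kK)) : forall k : 'I_K, `|hh n (tk k) - H (tk k)| <= eps / 5 by near: n.
have a4 : 2 * rho * dl n <= eps / 5 by near: n.
have a5 : 2 * rho * `|t - tk k| <= eps / 5 by rewrite (le_trans _ CK)// ler_wpM2l.
rewrite mulrDr in a1; rewrite (distrC (tk k) t) in a2.
have -> : hh n t - H t = (hh n t - hh n (tk k)) + (hh n (tk k) - H (tk k)) + (H (tk k) - H t) by ring.
rewrite (le_trans (ler_normD _ _))// (le_trans (lerD (ler_normD _ _) (lexx _)))//.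
lra.
Unshelve. all: by end_near. Qed.

Lemma cvg0_modulus (x : nat -> R) :
  (forall eps, 0 < eps -> exists C, \forall n \near U, `|x n| <= eps + C * dl n) ->
  x @ U --> (0 : R).
Proof.
move=> hx; apply/cvgrPdist_le => eps eps0.
have e2 : 0 < eps / 2 by rewrite divr_gt0.
have [C hC] := hx _ e2.
have c : C * dl n @[n --> U] --> C * 0 by apply: cvgMr; exact: step_cvg0.
rewrite mulr0 in c.
have {}c : \forall n \near U, C * dl n <= eps / 2 by apply: cvgr_le c _ _.
near=> n; rewrite sub0r normrN.
have h1 : `|x n| <= eps / 2 + C * dl n by near: n.
have h2 : C * dl n <= eps / 2 by near: n.
lra.
Unshelve. all: by end_near. Qed.

Let theta_itv n (i : nat) : (i < N n)%N -> 0 <= i%:R * dl n <= pi *+ 2.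
Proof.
move=> iN; rewrite mulr_ge0 ?(ltW (dl0 n))//=.
by rewrite -(step_full R (m0 n)) ler_wpM2r ?(ltW (dl0 n))// ler_nat ltnW.
Qed.

Lemma sum_edge_bound n : \sum_(i < N n) edge (m n) (h n) i%:Z <= 4 * pi * rho.
Proof.
have hge i : 0 <= h n i by exact/ltW/h0.
rewrite (le_trans (sum_edge_le (m4 n) (hN n) hge))//.
have : \sum_(i < N n) h n i%:Z <= (2 * rho) *+ N n.
  rewrite -[leRHS](_ : \sum_(i < N n) 2 * rho = _); last by rewrite sumr_const card_ord.
  by apply: ler_sum => i _; exact: polygon_le.
move=> /(ler_wpM2l (ltW (dl0 n)))/le_trans; apply.
have -> : dl n * ((2 * rho) *+ N n) = 2 * rho * ((N n)%:R * dl n).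
  by rewrite -[(2 * rho) *+ N n]mulr_natr; ring.
by rewrite (step_full R (m0 n)) le_eqVlt; apply/orP; left; apply/eqP; ring.
Qed.

(** Replacing the support numbers by [H] inside the power is harmless: [powR_holder] carries the
    uniform convergence through the power, and the sum of the edges is bounded. *)
Lemma moment_limit (psi : R -> R) : continuous psi ->
  \sum_(i < N n) edge (m n) (h n) i%:Z * (psi (i%:R * dl n) * H (i%:R * dl n) `^ (1 - p))
    @[n --> U] --> F psi.
Proof.
move=> cpsi; have [M M0 hM] := continuous_bounded_itv 0 (pi *+ 2) cpsi.
pose T n := \sum_(i < N n) edge (m n) (h n) i%:Z * h n i%:Z `^ (1 - p) *
  psi (i%:Z%:~R * (pi / (m n)%:R)).
pose D n := \sum_(i < N n) edge (m n) (h n) i%:Z *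
  (psi (i%:R * dl n) * (H (i%:R * dl n) `^ (1 - p) - h n i%:Z `^ (1 - p))).
have cT : T n @[n --> U] --> F psi by apply: cvg_trans (hF _ cpsi); exact: cvg_app.
have cD : D n @[n --> U] --> 0.
  apply: cvg0_modulus => eps eps0; exists 0.
  pose L := M * (4 * pi * rho) + 1.
  have L0 : 0 < L by rewrite ltr_wpDl// !mulr_ge0// pi_ge0.
  have q0 : 0 < 1 - p by rewrite subr_gt0.
  pose eta := (eps / L) `^ (1 - p)^-1.
  have eta0 : 0 < eta by rewrite powR_gt0// divr_gt0.
  have etaE : eta `^ (1 - p) = eps / L.
    by rewrite /eta -powRrM mulVf ?gt_eqF// powRr1// divr_ge0// ltW.
  have := limit_uniform eta eta0; apply: filterS => n hn.
  rewrite mul0r addr0 (le_trans (ler_norm_sum _ _ _))//.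
  apply: (@le_trans _ _ (\sum_(i < N n) edge (m n) (h n) i%:Z * (M * (eps / L)))).
    apply: ler_sum => i _; rewrite normrM gtr0_norm// ler_wpM2l ?(ltW (e0 _ _))//.
    rewrite normrM ler_pM//; first exact/hM/theta_itv.
    rewrite (le_trans (powR_holder _ _ _ _))//; [by rewrite gerBl ltW|exact: limit_ge0|exact/ltW/h0|].
    by rewrite -etaE ge0_ler_powR ?nnegrE ?(ltW q0) ?(ltW eta0)// distrC hn.
  rewrite -mulr_suml (le_trans (ler_wpM2r _ (sum_edge_bound n)))//.
    by rewrite mulr_ge0// divr_ge0// ltW.
  rewrite mulrA [_ * M]mulrC mulrCA ler_piMr ?(ltW eps0)//.
  by rewrite ler_pdivrMr// mul1r /L lerDl.
have -> : (fun n => \sum_(i < N n) edge (m n) (h n) i%:Z *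
    (psi (i%:R * dl n) * H (i%:R * dl n) `^ (1 - p))) = (fun n => T n + D n).
  apply/funext => n; rewrite /T /D -big_split; apply: eq_bigr => i _ /=.
  by rewrite -pmulrn -/(dl n); ring.
by rewrite -[F psi]addr0; exact: cvgD.
Qed.

(** The second difference is moved to the test function. The sum then splits into [A], the
    consistency error of the difference scheme, [B], the error of replacing the support numbers by
    [H], and [C], a Riemann sum. *)
Lemma weak_limit (phi phi1 phi2 : R -> R) :
  (forall x : R, is_derive x 1 phi (phi1 x)) -> (forall x : R, is_derive x 1 phi1 (phi2 x)) ->
  continuous phi2 -> periodic phi (pi *+ 2) ->
  \sum_(i < N n) edge (m n) (h n) i%:Z * phi (i%:R * dl n) @[n --> U] -->
    \int[lebesgue_measure]_(t in `[0, pi *+ 2]) (H t * (phi2 t + phi t)).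
Proof.
move=> D1 D2 c2 phi_per.
have cphi : continuous phi.
  by move=> x; apply/differentiable_continuous/derivable1_diffP; case: (D1 x).
pose psi t := phi2 t + phi t.
have cpsi : continuous psi by move=> t; apply: cvgD; [exact: c2|exact: cphi].
have [M M0 hM] := continuous_bounded_itv 0 (pi *+ 2) cphi.
have [M' M'0 hM'] := continuous_bounded_itv 0 (pi *+ 2) cpsi.
pose g n (i : int) := phi (i%:~R * dl n).
have gN n : int_periodic (N n) (g n).
  by move=> i; rewrite /g intrD mulrDl -[X in phi (_ + X)](_ : pi *+ 2 = _) ?phi_per// -(step_full R (m0 n)).
pose A n := \sum_(i < N n) h n i%:Z * (edge (m n) (g n) i%:Z - dl n * psi (i%:R * dl n)).
pose B n := \sum_(i < N n) (h n i%:Z - H (i%:R * dl n)) * (psi (i%:R * dl n) * dl n).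
pose C n := \sum_(i < N n) (H (i%:R * dl n) * psi (i%:R * dl n)) * dl n.
have step2 (x : R) n : 2 * rho * (x * dl n) *+ N n = 4 * pi * rho * x.
  rewrite -mulr_natr; transitivity (2 * rho * x * ((N n)%:R * dl n)); first by ring.
  by rewrite (step_full R (m0 n)); ring.
have cA : A n @[n --> U] --> 0.
  apply: cvg0_modulus => eps eps0.
  pose L := 4 * pi * rho + 1.
  have L0 : 0 < L by rewrite ltr_wpDl// !mulr_ge0// pi_ge0.
  have e2 : 0 < eps / L / 2 by rewrite !divr_gt0.
  have [K K0 hK] := uniform_modulus (-1) (pi *+ 2 + 1) c2 e2.
  exists (4 * pi * rho * (2 * K + 2 * M)); apply: nearW => n.
  have dl1 : dl n <= 1 by exact: step_le1.
  have key i : (i < N n)%N -> `|edge (m n) (g n) i%:Z - dl n * psi (i%:R * dl n)| <=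
      (eps / L + (2 * K + 2 * M) * dl n) * dl n.
    move=> iN; set t := i%:R * dl n; have /andP[t0 t2] := theta_itv n i iN.
    have S1 : `|phi (t + dl n) + phi (t - dl n) - 2 * phi t - dl n ^+ 2 * phi2 t| <=
        2 * (eps / L / 2 + K * dl n) * dl n ^+ 2.
      apply: (@second_difference R phi phi1 phi2 t (dl n) _ (dl0 n) D1 D2) => x.
      rewrite ler_norml => /andP[x1 x2].
      have h1 : -1 <= x <= pi *+ 2 + 1 by apply/andP; split; rewrite -/t in t0 t2; lra.
      have h2 : -1 <= t <= pi *+ 2 + 1 by apply/andP; split; rewrite -/t in t0 t2; lra.
      rewrite (le_trans (hK _ _ h1 h2))// lerD2l ler_wpM2l//.
      by rewrite ler_norml x1 x2.
    (* The cosine at 0 compares [2 - 2 * cos d] with [d ^ 2]; this difference is the source of the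
       term [phi] in [phi2 + phi]. *)
    have S2 : `|cos (0 + dl n) + cos (0 - dl n) - 2 * cos 0 - dl n ^+ 2 * (- cos 0)| <=
        2 * dl n * dl n ^+ 2.
      apply: (@second_difference R cos (fun x => - sin x) (fun x => - cos x) 0 (dl n) (dl n) (dl0 n)) => x xd.
      by rewrite -opprD normrN (le_trans (cos_lipschitz _ _)).
    rewrite add0r sub0r cosN cos0 in S2.
    have gE : dl n * (edge (m n) (g n) i%:Z - dl n * psi t) =
      (phi (t + dl n) + phi (t - dl n) - 2 * phi t - dl n ^+ 2 * phi2 t)
      - (cos (dl n) + cos (dl n) - 2 * 1 - dl n ^+ 2 * (- 1)) * phi t.
      have gp : g n (i%:Z + 1) = phi (t + dl n) by rewrite /g intrD mulrDl mul1r.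
      have gm : g n (i%:Z - 1) = phi (t - dl n) by rewrite /g intrB mulrBl mul1r.
      have g0 : g n i%:Z = phi t by [].
      rewrite /edge /discrete_op gp gm g0 -/(dl n) /psi.
      by field; rewrite gt_eqF.
    rewrite -(ler_pM2l (dl0 n)) -[X in X * `|_|](gtr0_norm (dl0 n)) -normrM gE.
    rewrite (le_trans (ler_normB _ _))//.
    have Mt : `|phi t| <= M by apply: hM; rewrite t0.
    have := ler_pM (normr_ge0 _) (normr_ge0 _) S2 Mt; rewrite -normrM.
    lra.
  rewrite /A (le_trans (ler_norm_sum _ _ _))//.
  apply: (@le_trans _ _ (\sum_(i < N n) 2 * rho * ((eps / L + (2 * K + 2 * M) * dl n) * dl n))).
    apply: ler_sum => i _; rewrite normrM gtr0_norm// ler_pM ?(ltW (h0 _ _))//; first exact: polygon_le.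
    exact: key.
  rewrite sumr_const card_ord step2.
  have : 4 * pi * rho * (eps / L) <= eps.
    by rewrite mulrCA ler_piMr ?(ltW eps0)// ler_pdivrMr// mul1r /L lerDl.
  lra.
have cB : B n @[n --> U] --> 0.
  apply: cvg0_modulus => eps eps0; exists 0.
  pose L := 2 * pi * M' + 1.
  have L0 : 0 < L by rewrite ltr_wpDl// !mulr_ge0// pi_ge0.
  have eL : 0 < eps / L by rewrite divr_gt0.
  have := limit_uniform (eps / L) eL; apply: filterS => n hn.
  rewrite mul0r addr0 (le_trans (ler_norm_sum _ _ _))//.
  apply: (@le_trans _ _ (\sum_(i < N n) (eps / L) * (M' * dl n))).
    apply: ler_sum => i _; rewrite normrM ler_pM//; first exact: hn.
    by rewrite normrM (gtr0_norm (dl0 n)) ler_wpM2r ?(ltW (dl0 n))//; exact/hM'/theta_itv.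
  rewrite sumr_const card_ord -mulr_natr.
  have -> : eps / L * (M' * dl n) * (N n)%:R = eps * ((M' * ((N n)%:R * dl n)) / L) by ring.
  rewrite (step_full R (m0 n)) ler_piMr ?(ltW eps0)// ler_pdivrMr// mul1r /L.
  by rewrite -[leLHS]addr0 lerD// le_eqVlt; apply/orP; left; apply/eqP; ring.
have cC : C n @[n --> U] --> \int[lebesgue_measure]_(t in `[0, pi *+ 2]) (H t * psi t).
  have cHpsi : continuous (fun t => H t * psi t).
    by move=> t; apply: cvgM; [exact: limit_continuous|exact: cpsi].
  apply: cvg_trans (cvg_comp _ _ m_oo (riemann_lebesgue cHpsi)); exact: cvg_app.
have -> : (fun n => \sum_(i < N n) edge (m n) (h n) i%:Z * phi (i%:R * dl n)) =
    (fun n => A n + B n + C n).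
  apply/funext => n.
  transitivity (\sum_(i < N n) g n i%:Z * edge (m n) (h n) i%:Z).
    by apply: eq_bigr => i _; rewrite mulrC /g -pmulrn.
  rewrite (edge_sym (gN n) (hN n)) /A /B /C -!big_split; apply: eq_bigr => i _ /=.
  by ring.
rewrite -[X in _ --> X]add0r -[X in _ --> X + _]addr0; apply: cvgD => //; exact: cvgD.
Qed.

(** The sum of [abs_sin] against the edges is a mixed area with a segment, bounded by twice the
    width of the polygon. If the width tended to 0, so would the sum of [sin ^ 2] against the
    weights, but its limit is the moment form at [(- sin t0, cos t0)], which is positive. *)
Lemma limit_width t0 : 0 < H t0 + H (t0 + pi).
Proof.
rewrite lt_neqAle addr_ge0 ?limit_ge0 ?andbT//; apply/eqP => /esym H0.
pose j n := angle_index n t0.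
pose w n i := edge (m n) (h n) i * h n i `^ (1 - p).
pose S n := \sum_(i < N n) w n i%:Z * sin ((i%:Z - j n)%:~R * dl n) ^+ 2.
have cS : S n @[n --> U] --> cos t0 ^+ 2 * F (fun t => sin t ^+ 2)
    - 2 * (cos t0 * sin t0) * F (fun t => cos t * sin t) + sin t0 ^+ 2 * F (fun t => cos t ^+ 2).
  have cc : continuous (fun t : R => cos t ^+ 2) by move=> t; apply: cvgM; exact: continuous_cos.
  have cs : continuous (fun t : R => sin t ^+ 2) by move=> t; apply: cvgM; exact: continuous_sin.
  have ccs : continuous (fun t : R => cos t * sin t).
    by move=> t; apply: cvgM; [exact: continuous_cos|exact: continuous_sin].
  have L phi : continuous phi -> \sum_(i < N n) w n i%:Z * phi (i%:Z%:~R * dl n) @[n --> U] --> F phi.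
    by move=> cphi; apply: cvg_trans (hF _ cphi); exact: cvg_app.
  have cj := angle_index_cvg t0.
  have ccj : cos ((j n)%:~R * dl n) @[n --> U] --> cos t0 by exact: cvg_comp cj (@continuous_cos R t0).
  have csj : sin ((j n)%:~R * dl n) @[n --> U] --> sin t0 by exact: cvg_comp cj (@continuous_sin R t0).
  have -> : S = (fun n => cos ((j n)%:~R * dl n) ^+ 2 * (\sum_(i < N n) w n i%:Z * sin (i%:Z%:~R * dl n) ^+ 2)
      - 2 * (cos ((j n)%:~R * dl n) * sin ((j n)%:~R * dl n)) *
        (\sum_(i < N n) w n i%:Z * (cos (i%:Z%:~R * dl n) * sin (i%:Z%:~R * dl n)))
      + sin ((j n)%:~R * dl n) ^+ 2 * (\sum_(i < N n) w n i%:Z * cos (i%:Z%:~R * dl n) ^+ 2)).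
    apply/funext => n; rewrite !mulr_sumr -sumrB -big_split; apply: eq_bigr => i _ /=.
    by rewrite intrB mulrBl sinB; ring.
  apply: cvgD; [apply: cvgB|].
  - by apply: cvgM (L _ cs); apply: cvgM.
  - by apply: cvgM (L _ ccs); apply: cvgMr; apply: cvgM.
  - by apply: cvgM (L _ cc); apply: cvgM.
have Spos : 0 < cos t0 ^+ 2 * F (fun t => sin t ^+ 2)
    - 2 * (cos t0 * sin t0) * F (fun t => cos t * sin t) + sin t0 ^+ 2 * F (fun t => cos t ^+ 2).
  have ab : (- sin t0, cos t0) != (0, 0).
    apply/eqP => -[/eqP]; rewrite oppr_eq0 => /eqP s0 c0.
    by have := cos2Dsin2 t0; rewrite s0 c0 expr0n /= addr0 => /eqP; rewrite eq_sym oner_eq0.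
  have := F_gt0 _ _ ab.
  by set x := F _; set y := F _; set z := F _; lra.
pose K := (2 * rho) `^ (1 - p).
have Sle n : S n <= K * (2 * (hh n t0 + hh n (t0 + pi))).
  have aN : int_periodic (N n) (fun i => abs_sin R (m n) (i - j n)).
    move=> i; rewrite addrAC.
    by have := int_periodicM 2 (i - j n) (abs_sin_periodic R (m0 n)); rewrite (_ : 2 * (m n)%:Z = (N n)%:Z)// /N; lia.
  apply: (@le_trans _ _ (K * \sum_(i < N n) abs_sin R (m n) (i%:Z - j n) * edge (m n) (h n) i%:Z)).
    rewrite mulr_sumr; apply: ler_sum => i _; rewrite /w.
    have -> : K * (abs_sin R (m n) (i%:Z - j n) * edge (m n) (h n) i%:Z) =
      edge (m n) (h n) i%:Z * K * abs_sin R (m n) (i%:Z - j n) by ring.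
    apply: ler_pM; first by rewrite mulr_ge0 ?powR_ge0// ltW.
    - exact: sqr_ge0.
    - rewrite ler_wpM2l ?(ltW (e0 _ _))// ge0_ler_powR ?nnegrE ?subr_ge0 ?(ltW p1) ?(ltW (h0 _ _))//.
      + by rewrite mulr_ge0.
      + exact: polygon_le.
    - by rewrite -[leLHS]real_normK ?num_real// expr2 /abs_sin ler_piMl// sin_max.
  rewrite ler_wpM2l ?powR_ge0//.
  (* The edges are now those of the segment, which sit on the two indices [j n] and [j n + m n]
     modulo the period. *)
  rewrite (edge_sym aN (hN n)).
  have eE i : edge (m n) (fun i => abs_sin R (m n) (i - j n)) i = edge (m n) (abs_sin R (m n)) (i - j n).
    by rewrite /edge /discrete_op [i + 1 - _]addrAC [i - 1 - _]addrAC.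
  under eq_bigr do rewrite eE.
  have GN : int_periodic (N n) (fun i => h n i * edge (m n) (abs_sin R (m n)) (i - j n)).
    by move=> i; rewrite -!eE (int_periodic_edge aN) hN.
  rewrite -(@sum_shift _ (N n) _ (j n) GN).
  under eq_bigr do rewrite addrK.
  have sd0 : 0 <= sin (dl n) by apply: le_trans (sin_step_ge R (m4 n)); apply: divr_ge0 => //; exact/ltW/dl0.
  have sdd : 2 * sin (dl n) / dl n <= 2.
    rewrite ler_pdivrMr// ler_wpM2l//.
    by have := sin_le_id (ltW (dl0 n)); rewrite ger0_norm.
  have half (k : int) : (k = 0) \/ (k = (m n)%:Z) ->
    \sum_(i < m n) h n (i%:Z + k + j n) * edge (m n) (abs_sin R (m n)) (i%:Z + k) <= h n (k + j n) * 2.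
    move=> k0.
    have dk (i : nat) : ((m n)%:Z %| i%:Z + k)%Z = ((m n)%:Z %| i%:Z)%Z.
      by case: k0 => ->; rewrite ?addr0// rpredDr// dvdzz.
    rewrite (bigD1 (Ordinal (m0 n)))//= big1 ?addr0; last first.
      move=> i i0; rewrite /edge discrete_op_abs_sin// dk.
      rewrite (_ : (_ %| _)%Z = false) ?mul0r ?mulr0//.
      apply/negbTE; rewrite /dvdz /=; apply/negP => /dvdn_leq.
      have : (0 < i)%N by rewrite lt0n; apply: contraNneq i0 => i0; apply/eqP/val_inj.
      by move=> + /[dup] => -> /(_ isT); rewrite leqNgt ltn_ord.
    rewrite add0r ler_wpM2l ?(ltW (h0 _ _))// /edge discrete_op_abs_sin//.
    by have := dk 0%N; rewrite add0r dvdz0 => ->.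
  rewrite /N -addnn big_split_ord /=.
  have -> : hh n t0 = h n (0 + j n) by rewrite add0r.
  have -> : hh n (t0 + pi) = h n ((m n)%:Z + j n).
    by rewrite /hh -(step_half R (m0 n)) pmulrn angle_index_shift addrC.
  rewrite mulrC mulrDl lerD//.
    by apply: le_trans (half 0 (or_introl erefl)); apply: ler_sum => i _; rewrite addr0.
  apply: le_trans (half (m n)%:Z (or_intror erefl)); apply: ler_sum => i _.
  by rewrite PoszD [(m n)%:Z + i%:Z]addrC.
have cK : K * (2 * (hh n t0 + hh n (t0 + pi))) @[n --> U] --> K * (2 * (H t0 + H (t0 + pi))).
  by apply: cvgMr; apply: cvgMr; apply: cvgD.
rewrite H0 !mulr0 in cK.
have : cos t0 ^+ 2 * F (fun t => sin t ^+ 2)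
    - 2 * (cos t0 * sin t0) * F (fun t => cos t * sin t) + sin t0 ^+ 2 * F (fun t => cos t ^+ 2) <= 0.
  by apply: ler_cvg_to cS cK _; exact: nearW.
by rewrite leNgt Spos.
Qed.

End PolygonLimit.

Arguments limit_exists {R m h rho} m4 hP h_vertex U {UU}.
Arguments limit_ge0 {R m h} hP {U UU H} HE t.
Arguments limit_shift {R m h} m4 hP {U UU H} HE t.
Arguments limit_continuous {R m h rho} m4 m_oo hP h_vertex {U UU} oU {H} HE.
Arguments limit_support {R m h rho} m4 m_oo hP h_vertex {U UU} oU {H} HE t.
Arguments limit_width {R p} p0 p1 {m h rho F} m4 m_oo hP h_vertex hF F_gt0 {U UU} oU {H} HE t0.
Arguments weak_limit {R m h rho} m4 m_oo hP h_vertex {U UU} oU {H} HE {phi phi1 phi2}.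
Arguments moment_limit {R p} p0 p1 {m h rho F} m4 m_oo hP h_vertex hF {U UU} oU {H} HE {psi}.
Arguments sum_edge_bound {R m h rho} m4 hP h_vertex n.

(** * Identification of the limit *)

Set Implicit Arguments.

Section TestFunctions.
Variables (R : realType) (c : R).

(** Continuous approximations from below of the indicator of []a, c[]. They vanish at [c], and at 0
    if [a >= 0], hence take equal values at the two ends of the period. *)
Definition trapezoid (a : R) (n : nat) (t : R) : R :=
  Num.min 1 (n%:R * Num.max 0 (Num.min (t - a) (c - t))).

Lemma trapezoid_continuous a n : continuous (trapezoid a n).
Proof.
pose f1 (t : R) : R^o := Num.min (t - a) (c - t).
pose f2 (t : R) : R^o := Num.max 0 (f1 t).
have c1 : continuous f1.
  move=> t; apply: (@continuous_min _ _ (fun t => t - a : R^o) (fun t => c - t : R^o)).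
    by apply: cvgB; [exact: cvg_id|exact: cvg_cst].
  by apply: cvgB; [exact: cvg_cst|exact: cvg_id].
have c2 : continuous f2.
  by move=> t; apply: (@continuous_max _ _ (fun=> 0 : R^o) f1); [exact: cvg_cst|exact: c1].
move=> t; apply: (@continuous_min _ _ (fun=> 1 : R^o) (fun t => n%:R * f2 t : R^o)).
  exact: cvg_cst.
by apply: cvgMr; exact: c2.
Qed.

Lemma trapezoid_ge0 a n t : 0 <= trapezoid a n t.
Proof. by rewrite le_min ler01 mulr_ge0// le_max lexx. Qed.

Lemma trapezoid_le1 a n t : trapezoid a n t <= 1.
Proof. by rewrite ge_min lexx. Qed.

Lemma trapezoid_eq0 a n t : t <= a \/ c <= t -> trapezoid a n t = 0.
Proof.
move=> h; have e0 : Num.min (t - a) (c - t) <= 0 by rewrite ge_min !subr_le0; apply/orP.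
by rewrite /trapezoid (max_idPl e0) mulr0 min_r.
Qed.

Lemma trapezoid_cvg a t : trapezoid a n t @[n --> \oo] --> (\1_(`]a, c[) t : R).
Proof.
have [tac|tac] := boolP ((a < t) && (t < c)); last first.
  rewrite indicE memNset ?in_itv //=; last first.
    by rewrite /= in_itv /=; apply/negP.
  have -> : (fun n => trapezoid a n t) = (fun=> 0); last exact: cvg_cst.
  by apply/funext => n; apply: trapezoid_eq0; apply/orP; rewrite negb_and -!leNgt in tac.
rewrite indicE mem_set /= ?in_itv //=.
have /andP[at' tc] := tac.
pose e := Num.min (t - a) (c - t).
have e0 : 0 < e by rewrite lt_min !subr_gt0 at' tc.
apply/cvgrPdist_le => eps eps0; near=> n.
rewrite /trapezoid -/e (_ : Num.max 0 e = e); last by apply/max_idPr/ltW.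
rewrite (_ : Num.min 1 _ = 1) ?subrr ?normr0 ?(ltW eps0)//.
apply/min_idPl; rewrite -ler_pdivrMr// mul1r.
by near: n; exact: nbhs_infty_ger.
Unshelve. all: by end_near. Qed.

Lemma Rintegral_trapezoid d (T : measurableType d) (mu : {measure set T -> \bar R})
    (X w : T -> R) (a : R) : measurable_fun setT X -> (forall x, 0 <= w x) ->
  mu.-integrable (X @^-1` `[0, c[) (EFin \o w) -> 0 <= a ->
  \int[mu]_(x in X @^-1` `[0, c[) (trapezoid a n (X x) * w x) @[n --> \oo] -->
    \int[mu]_(x in X @^-1` `]a, c[) w x.
Proof.
move=> mX w0 iw a0; set D := X @^-1` `[0, c[.
have mD : measurable D by exact: measurable_preimage_itv.
have mac : measurable (X @^-1` `]a, c[) by exact: measurable_preimage_itv.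
have mw : measurable_fun D w by apply/measurable_EFinP; exact: measurable_int iw.
pose fn n (x : T) := (trapezoid a n (X x) * w x)%:E.
pose fl (x : T) := (\1_(`]a, c[) (X x) * w x)%:E.
have mfn n : measurable_fun D (fn n).
  apply/measurable_EFinP; apply: measurable_funM => //; apply: measurable_funTS.
  by apply: measurableT_comp => //; apply: continuous_measurable_fun; exact: trapezoid_continuous.
have mfl : measurable_fun D fl.
  apply/measurable_EFinP; apply: measurable_funM => //; apply: measurable_funTS.
  by apply: measurableT_comp => //; exact: measurable_indic.
have cv : {ae mu, forall x, D x -> fn ^~ x @ \oo --> fl x}.
  apply: aeW => x _; apply: cvg_EFin; first exact: nearW.
  by apply: cvgMl; exact: trapezoid_cvg.
have dom : {ae mu, forall x n, D x -> (`|fn n x| <= (EFin \o w) x)%E}.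
  apply: aeW => x n _; rewrite /fn /= lee_fin normrM !ger0_norm ?trapezoid_ge0//.
  by rewrite ler_piMl// trapezoid_le1.
have [ifl _ h] := dominated_convergence mD mfn mfl cv iw dom.
have E : (\int[mu]_(x in D) fl x = \int[mu]_(x in X @^-1` `]a, c[) (w x)%:E)%E.
  rewrite -[RHS](_ : \int[mu]_(x in D `&` X @^-1` `]a, c[) (w x)%:E = _)%E; last first.
    congr (integral _ _ _); apply/setIidr => x /=; rewrite /D /= !in_itv /=.
    by move=> /andP[/ltW ax ->]; rewrite (le_trans a0 ax).
  rewrite integral_mkcondr; apply: eq_integral => x _.
  rewrite /fl patchE; case: ifPn => xX.
    by rewrite indicE mem_set ?mul1r//; move: xX; rewrite inE.
  rewrite indicE memNset ?mul0r//.
  by move: xX; rewrite notin_setE.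
have finl : (\int[mu]_(x in D) fl x \is a fin_num)%E by exact: integrable_fin_num.
apply: fine_cvg; rewrite /Rintegral fineK -E//; exact: h.
Qed.

End TestFunctions.

(** * From test functions to Borel sets *)

Section DensityIdentity.
Variable R : realType.
Let LL := lebesgue_line R.
Let cmu : {measure set LL -> \bar R} := @completed_lebesgue_measure R.
Variables (mu : {finite_measure set (measurableTypeR R) -> \bar R}) (c : R) (G w : R -> R).
Hypotheses (c0 : 0 < c) (G0 : forall t, 0 <= G t) (cG : continuous G) (w0 : forall t, 0 <= w t)
  (mw : measurable_fun [set: LL] (w : LL -> R))
  (iw : cmu.-integrable (`[0, c[%classic : set LL) (EFin \o w)).
Hypothesis GwE : forall psi : R -> R, continuous psi -> psi c = psi 0 ->
  \int[mu]_(t in `[0, c[) (psi t * G t) = \int[cmu]_(t in (`[0, c[%classic : set LL)) (psi t * w t).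

Let I : set R := `[0, c[%classic.

Let iG : mu.-integrable I (EFin \o G).
Proof.
have [M M0 hM] := continuous_bounded_itv 0 c cG.
apply: measurable_bounded_integrable.
- exact: measurable_itv.
- by rewrite -ge0_fin_numE ?measure_ge0//; apply: fin_num_measure; exact: measurable_itv.
- by apply: measurable_funTS; exact: continuous_measurable_fun.
exists M; split; first exact: num_real.
move=> z Mz x /=; rewrite /I /= in_itv /= => /andP[x0 xc].
by rewrite (le_trans (hM x _))// ?x0 ?(ltW xc)// ltW.
Qed.

Let same (A : set R) :=
  (\int[mu]_(t in (A `&` I : set (measurableTypeR R))) (G t)%:E =
   \int[cmu]_(t in (A `&` I : set LL)) (w t)%:E)%E.

Let mIR : measurable (I : set (measurableTypeR R)). Proof. exact: measurable_itv. Qed.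
Let mIL : measurable (I : set LL). Proof. exact: measurable_lebesgue_line. Qed.

Let same_fine (A : set R) : measurable (A : set (measurableTypeR R)) ->
  \int[mu]_(t in (A `&` I : set (measurableTypeR R))) G t =
  \int[cmu]_(t in (A `&` I : set LL)) w t -> same A.
Proof.
move=> mA E; rewrite /same.
have mAI : measurable (A `&` I : set (measurableTypeR R)) by exact: measurableI.
have mAL : measurable (A `&` I : set LL) by exact: measurable_lebesgue_line.
have f1 : mu.-integrable (A `&` I : set (measurableTypeR R)) (EFin \o G).
  by apply: integrableS iG => //; exact: subIsetr.
have f2 : cmu.-integrable (A `&` I : set LL) (EFin \o w).
  by apply: integrableS iw => //; exact: subIsetr.
rewrite -[LHS]fineK; last exact: integrable_fin_num f1.
by rewrite -[RHS]fineK; [congr EFin|exact: integrable_fin_num f2].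
Qed.

Let same_setT : same setT.
Proof.
apply: same_fine => //; rewrite setTI.
transitivity (\int[mu]_(t in I) (1 * G t)).
  by apply: eq_Rintegral => t _; rewrite mul1r.
rewrite (GwE (psi := fun=> 1))//; last by move=> t; exact: cvg_cst.
by apply: eq_Rintegral => t _; rewrite mul1r.
Qed.

Let same_ray (a : R) : same `]a, +oo[.
Proof.
(* A ray starting below 0 contains the whole period; otherwise the trapezoids are admissible test
   functions. *)
have [a0|a0] := ltP a 0.
  rewrite /same (_ : `]a, +oo[%classic `&` I = setT `&` I); first exact: same_setT.
  apply/seteqP; split => t /=; rewrite /I /= !in_itv /= ?andbT; first by case.
  by move=> [_ /andP[t0 tc]]; rewrite t0 tc (lt_le_trans a0 t0).
have E : `]a, +oo[%classic `&` I = `]a, c[%classic.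
  apply/seteqP; split => t /=; rewrite /I /= !in_itv /= ?andbT; first by move=> [-> /andP[_ ->]].
  by move=> /andP[at' ->]; rewrite at' (le_trans a0 (ltW at')).
apply: same_fine; first exact: measurable_itv.
rewrite E.
have c1 := @Rintegral_trapezoid R c _ (measurableTypeR R) mu id G a (@measurable_id _ _ setT) G0 iG a0.
have c2 := @Rintegral_trapezoid R c _ LL cmu id w a (@measurable_id_lebesgue_line R) w0 iw a0.
apply: (cvg_unique _ c1); first exact: Rhausdorff.
apply: cvg_trans c2; apply: near_eq_cvg; apply: nearW => n.
rewrite !preimage_id; symmetry; apply: GwE; first exact: trapezoid_continuous.
by rewrite !trapezoid_eq0//; [left|right].
Qed.

(** The open rays form a pi-system generating the Borel sets, and both sides are finite with equal
    totals. The comparison is made between integrals because [mu] is defined on Borel sets and [cmu]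
    on Lebesgue measurable sets. *)
Lemma density_identity (A : set (measurableTypeR R)) : measurable A -> A `<=` `[0, c[ ->
  (\int[mu]_(t in A) (G t)%:E = \int[cmu]_(t in (A : set LL)) (w t)%:E)%E.
Proof.
move=> mA AI; suff : same A by rewrite /same (setIidl (AI : A `<=` I)).
have mE : @measurable _ (measurableTypeR R) = <<s (@RGenOInfty.G R) >> by exact: RGenOInfty.measurableE.
have mG : measurable_fun (setT : set (measurableTypeR R)) (EFin \o G).
  by apply/measurable_EFinP; exact: continuous_measurable_fun.
have mwE : measurable_fun (setT : set LL) (EFin \o w) by apply/measurable_EFinP.
apply: (@dynkin_induction _ (measurableTypeR R) (@RGenOInfty.G R) same) => //.
- move=> _ _ [x ->] [y ->]; exists (Num.max x y).
  by apply/seteqP; split => t /=; rewrite !in_itv /= !andbT gt_max => /andP.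
- by move=> _ [x ->].
- move=> S mS SS; apply: same_fine; first exact: measurableC.
  have compl d (T : measurableType d) (nu : {measure set T -> \bar R}) (E J : set T) (g : T -> R) :
      measurable E -> measurable J -> nu.-integrable J (EFin \o g) ->
      \int[nu]_(t in ~` E `&` J) g t = \int[nu]_(t in J) g t - \int[nu]_(t in E `&` J) g t.
    move=> mE' mJ ig; apply/eqP; rewrite eq_sym subr_eq; apply/eqP.
    have JE : J = (~` E `&` J) `|` (E `&` J) by rewrite -setIUl setUC setUCr setTI.
    rewrite [in LHS]JE Rintegral_setU//.
    - by apply: measurableI => //; exact: measurableC.
    - exact: measurableI.
    - by rewrite -JE.
    - by apply/disj_set2P; rewrite setIACA setICl set0I.
  rewrite (compl _ _ mu S I G)// (compl _ _ cmu S I w)//; last exact: measurable_lebesgue_line.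
  have := same_setT; rewrite /same setTI => /(congr1 fine) h1.
  have /(congr1 fine) h2 := SS.
  by rewrite /Rintegral h1 h2.
- move=> S mS tS SS; rewrite /same setI_bigcupl.
  have tSI : trivIset setT (fun k => S k `&` I) by exact: trivIset_setIr.
  rewrite ge0_integral_bigcup//.
  + rewrite ge0_integral_bigcup//.
    * by apply: eq_eseriesr => k _; exact: SS.
    * by move=> k; apply: measurable_lebesgue_line; exact: measurableI.
    * exact: measurable_funTS.
    * by move=> t _; rewrite lee_fin.
  + by move=> k; exact: measurableI.
  + exact: measurable_funTS.
  + by move=> t _; rewrite lee_fin.
- by rewrite -mE.
Qed.

End DensityIdentity.

(** * The convex body of the limit *)

Section SupportBody.
Variables (R : realType) (H : R -> R) (rho : R).
Hypotheses (H0 : forall t, 0 <= H t)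
  (H_support : forall t, exists a b, [/\ a * cos t + b * sin t = H t,
    forall s, a * cos s + b * sin s <= H s, `|a| <= rho & `|b| <= rho])
  (H_width : forall t, 0 < H t + H (t + pi)).

(** The Wulff shape of [H]. Its support function could be smaller than [H]; the contact points of
    [H_support] exclude this. *)
Definition support_body : set (R * R) := [set x | forall t, x.1 * cos t + x.2 * sin t <= H t].

Lemma support_bodyP : is_support_function support_body H.
Proof.
move=> t; split; last by move=> x; exact.
by have [a [b [ab Kab _ _]]] := H_support t; exists (a, b).
Qed.

Lemma support_bound t : H t <= 2 * rho.
Proof.
have [a [b [<- _ ar br]]] := H_support t.
rewrite (le_trans (ler_norm _))// (le_trans (ler_normD _ _))// !normrM.
have -> : 2 * rho = rho + rho by ring.
rewrite lerD//; rewrite -[leRHS]mulr1 ler_pM ?cos_max ?sin_max//.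
Qed.

Lemma support_body_compact : compact support_body.
Proof.
pose B := `[- (2 * rho), 2 * rho]%classic.
apply: (@subclosed_compact _ _ (B `*` B)).
- rewrite (_ : support_body = \bigcap_(t in setT) [set x | x.1 * cos t + x.2 * sin t <= H t]); last first.
    by apply/seteqP; split => x Kx t; [move=> _|]; exact: Kx.
  apply: closed_bigI => t _.
  apply: (@preimage_closed _ _ (fun x : R * R => x.1 * cos t + x.2 * sin t) [set y | y <= H t]).
    move=> x _; apply: cvgD; apply: cvgMl; [exact: cvg_fst|exact: cvg_snd].
  exact: closed_le.
- by apply: compact_setX; exact: segment_compact.
move=> x Kx; split; rewrite /B /= in_itv /=.
  have := Kx 0; have := Kx pi; rewrite cos0 sin0 cospi sinpi !mulr0 !addr0 mulr1 mulrN1 => h1 h2.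
  have := support_bound 0; have := support_bound pi => h3 h4.
  by apply/andP; split; lra.
have := Kx (pi / 2); have := Kx (- (pi / 2)).
rewrite cosN sinN cos_pihalf sin_pihalf !mulr0 !add0r mulr1 mulrN1 => h1 h2.
have := support_bound (pi / 2); have := support_bound (- (pi / 2)) => h3 h4.
by apply/andP; split; lra.
Qed.

Lemma support_body_convex : convex_set support_body.
Proof.
apply/convex_setW => x y; rewrite !inE => Kx Ky k k0 k1; rewrite inE => t.
have -> : (conv k x y).1 = k%:num * x.1 + (1 - k%:num) * y.1 by [].
have -> : (conv k x y).2 = k%:num * x.2 + (1 - k%:num) * y.2 by [].
have := Kx t; have := Ky t => h1 h2.
have a1 : k%:num * (x.1 * cos t + x.2 * sin t) <= k%:num * H t by rewrite ler_wpM2l// ltW.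
have a2 : (1 - k%:num) * (y.1 * cos t + y.2 * sin t) <= (1 - k%:num) * H t.
  by rewrite ler_wpM2l// subr_ge0 ltW.
lra.
Qed.

(* Two boundary points in independent directions span, with the origin, a
   nondegenerate triangle contained in the body. *)
Lemma support_body_interior : (support_body)° !=set0.
Proof.
have pick t : exists2 s, (s = t \/ s = t + pi) & 0 < H s.
  have := H_width t; have [Ht _|Ht] := ltP 0 (H t); first by exists t; [left|].
  by move=> w; exists (t + pi); [right|lra].
have [s0 _ Hs0] := pick 0.
have [a1 [a2 [aE aK _ _]]] := H_support s0.
have A0 : 0 < a1 ^+ 2 + a2 ^+ 2.
  rewrite lt_neqAle addr_ge0 ?sqr_ge0 ?andbT//; apply/eqP => /esym/eqP.
  rewrite paddr_eq0 ?sqr_ge0// !sqrf_eq0 => /andP[/eqP z1 /eqP z2].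
  by move: Hs0; rewrite -aE z1 z2 !mul0r addr0 ltxx.
(* A direction orthogonal to the first contact point: the wave takes opposite values at 0 and [pi].
   It is reversed below if [H] vanishes there. *)
have [s s_itv sE] : exists2 s, s \in `[0, pi] & a1 * cos s + a2 * sin s = 0.
  apply: (@IVT R (fun s => a1 * cos s + a2 * sin s) 0 pi 0 (pi_ge0 R)).
    apply: continuous_subspaceT => s; apply: cvgD; apply: cvgMr.
      exact: continuous_cos.
    exact: continuous_sin.
  rewrite cos0 sin0 cospi sinpi !mulr0 !addr0 mulr1 mulrN1.
  by case: (leP a1 (- a1)) => h; apply/andP; split; lra.
have [s' ss' Hs'] := pick s.
have s'E : a1 * cos s' + a2 * sin s' = 0.
  case: ss' => ->//; rewrite cosDpi sinDpi !mulrN -opprD sE oppr0 //.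
have [b1 [b2 [bE bK _ _]]] := H_support s'.
pose D := a1 * b2 - a2 * b1.
have D0 : D != 0.
  apply/eqP => D0.
  have : (a1 ^+ 2 + a2 ^+ 2) * (b1 * cos s' + b2 * sin s') =
    (a1 * b1 + a2 * b2) * (a1 * cos s' + a2 * sin s') + D * (a1 * sin s' - a2 * cos s').
    by rewrite /D; ring.
  rewrite D0 s'E bE mulr0 mul0r addr0 => /eqP.
  by rewrite mulf_eq0 (gt_eqF A0) (gt_eqF Hs').
(* Barycentric coordinates relative to the two contact points, with the origin as third vertex; [y0]
   is the centroid. *)
pose al (y : R * R) := (y.1 * b2 - y.2 * b1) / D.
pose be (y : R * R) := (a1 * y.2 - a2 * y.1) / D.
have cal : continuous al.
  move=> y; apply: cvgMl; apply: cvgB; apply: cvgMl; [exact: cvg_fst|exact: cvg_snd].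
have cbe : continuous be.
  move=> y; apply: cvgMl; apply: cvgB; apply: cvgMr; [exact: cvg_snd|exact: cvg_fst].
pose y0 : R * R := ((a1 + b1) / 3, (a2 + b2) / 3).
have al0 : al y0 = 1 / 3 by rewrite /al /y0 /D /=; field; rewrite -/D D0.
have be0 : be y0 = 1 / 3 by rewrite /be /y0 /D /=; field; rewrite -/D D0.
exists y0; rewrite /interior /=.
have N1 : \forall y \near y0, 0 < al y by apply: cvgr_gt (cal y0) _ _; rewrite al0.
have N2 : \forall y \near y0, 0 < be y by apply: cvgr_gt (cbe y0) _ _; rewrite be0.
have N3 : \forall y \near y0, al y + be y < 1.
  apply: (@cvgr_lt _ _ (nbhs y0) _ (fun y => al y + be y) (al y0 + be y0)).
    by apply: cvgD; [exact: cal|exact: cbe].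
  by rewrite al0 be0; lra.
near=> y; move=> t.
have h1 : 0 < al y by near: y.
have h2 : 0 < be y by near: y.
have h3 : al y + be y < 1 by near: y.
have -> : y.1 * cos t + y.2 * sin t =
    al y * (a1 * cos t + a2 * sin t) + be y * (b1 * cos t + b2 * sin t).
  by rewrite /al /be /D; field; rewrite -/D D0.
have e1 := ler_wpM2l (ltW h1) (aK t); have e2 := ler_wpM2l (ltW h2) (bK t).
(* The weight left to the origin, [1 - al y - be y], is absorbed by [H t >= 0]. *)
have e3 : (al y + be y) * H t <= 1 * H t by rewrite ler_wpM2r// ltW.
lra.
Unshelve. all: by end_near. Qed.

Lemma support_body_convex_body : convex_body support_body.
Proof.
split; [exact: support_body_compact|exact: support_body_convex|exact: support_body_interior].
Qed.

End SupportBody.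

(** The measure [mu] is the weak limit of the edge measures along [U]. The distributional equation
    and the density identity each follow from computing the limit of one sum in two ways: once
    against [mu], once against Lebesgue measure. *)
Theorem corollary1p5 (R : realType) (p : R) (p_gt0 : 0 < p) (p_lt1 : p < 1)
    (f : R -> R) (f_ge0 : forall t, 0 <= f t)
    (f_meas : lebesgue_measurable_fun f)
    (f_per : periodic f (pi *+ 2))
    (f_int_gt0 :
      (0 < \int[completed_lebesgue_measure]_(t in `[0%R, (pi *+ 2)%R]) (f t)%:E)%E)
    (f_int_fin :
      (\int[completed_lebesgue_measure]_(t in `[0%R, (pi *+ 2)%R]) (f t)%:E < +oo)%E) :
  exists h : R -> R, weak_solution p f h.
Proof.
have [m [h [rho [m4 m_oo hP h_vertex hF]]]] :=
  polygon_sequence f_ge0 f_meas f_int_gt0 f_int_fin p_gt0 p_lt1.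
have F_gt0 := f_moment_gt0 f_ge0 f_meas f_int_gt0 f_int_fin.
have [U [UU oU]] := ultraFilterLemma eventually_filter.
have [H HE] := limit_exists m4 hP h_vertex U.
have H0 t : 0 <= H t by apply: (limit_ge0 hP HE).
have Hper t : H (t + pi *+ 2) = H t by apply: (limit_shift m4 hP HE).
have cH : continuous H by apply: (limit_continuous m4 m_oo hP h_vertex oU HE).
have H_support t : exists a b, [/\ a * cos t + b * sin t = H t,
    forall s, a * cos s + b * sin s <= H s, `|a| <= rho & `|b| <= rho].
  by apply: (limit_support m4 m_oo hP h_vertex oU HE).
have H_width t : 0 < H t + H (t + pi).
  by apply: (limit_width p_gt0 p_lt1 m4 m_oo hP h_vertex hF F_gt0 oU HE).
have p2 : (0 : R) < pi *+ 2 by rewrite mulrn_wgt0// pi_gt0.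
have m0 n : (0 < m n)%N by exact: leq_trans (m4 n).
have dl0 n : (0 : R) < pi / (m n)%:R by exact: step_gt0.
have [mu [mu0 muE]] : exists mu : {finite_measure set (measurableTypeR R) -> \bar R},
    mu (~` `[0, pi *+ 2[) = 0%E /\
    forall phi : R -> R, continuous phi -> phi (pi *+ 2) = phi 0 ->
    \sum_(k < (m n).*2) edge (m n) (h n) k%:Z * phi (k%:R * (pi / (m n)%:R)) @[n --> U] -->
      \int[mu]_(t in `[0, pi *+ 2[) phi t.
  apply: (@weak_compactness R (pi *+ 2) p2 U UU (fun n => (m n).*2)
    (fun n k => edge (m n) (h n) k%:Z) (fun n k => k%:R * (pi / (m n)%:R)) (4 * pi * rho)).
  - by move=> n k; have [_ /(_ k%:Z)[_ /ltW]] := hP n.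
  - move=> n; rewrite (bigD1 (Ordinal (period_gt0 (m4 n))))//= ltr_wpDr//.
      by apply: sumr_ge0 => k _; have [_ /(_ k%:Z)[_ /ltW]] := hP n.
    by have [_ /(_ 0)[]] := hP n.
  - exact: (sum_edge_bound m4 hP h_vertex).
  - by move=> n i j ij; rewrite ler_wpM2r ?(ltW (dl0 n))// ler_nat.
  - move=> n k kn; rewrite mulr_ge0 ?(ltW (dl0 n))//=.
    by rewrite -(step_full R (m0 n)) ler_wpM2r ?(ltW (dl0 n))// ler_nat.
exists H; split => //.
- exists (support_body H); split.
  + exact: (support_body_convex_body H0 H_support H_width).
  + by move=> t /=; rewrite !mul0r addr0.
  + exact: (support_bodyP H_support).
- exists mu.
    split => // phi sphi phi_per.
    have D1 (x : R) : is_derive x 1 phi (derive1n 1 phi x).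
      by apply: DeriveDef; [exact: (sphi 0%N)|rewrite /= derive1E].
    have D2 (x : R) : is_derive x 1 (derive1n 1 phi) (derive1n 2 phi x).
      by apply: DeriveDef; [exact: (sphi 1%N)|rewrite [RHS]derive1E].
    have c2 : continuous (derive1n 2 phi).
      by move=> x; apply/differentiable_continuous/derivable1_diffP; exact: (sphi 2%N).
    have c0 : continuous phi.
      by move=> x; apply/differentiable_continuous/derivable1_diffP; exact: (sphi 0%N).
    have phi2 : phi (pi *+ 2) = phi 0 by rewrite -[in LHS](add0r (pi *+ 2)) phi_per.
    have L : \sum_(k < (m n).*2) edge (m n) (h n) k%:Z * phi (k%:R * (pi / (m n)%:R)) @[n --> U] -->
        \int[lebesgue_measure]_(t in `[0, pi *+ 2]) (H t * (derive1n 2 phi t + phi t)).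
      by apply: (weak_limit m4 m_oo hP h_vertex oU HE D1 D2 c2 phi_per).
    exact: (cvg_unique _ L (muE phi c0 phi2)).
have q0 : 0 < 1 - p by rewrite subr_gt0.
have q1 : 1 - p <= 1 by rewrite gerBl ltW.
have cG : continuous (fun t => H t `^ (1 - p)).
  have -> : (fun t => H t `^ (1 - p)) = (fun x => `|x| `^ (1 - p)) \o H.
    by apply/funext => t /=; rewrite ger0_norm.
  by move=> t; apply: continuous_comp; [exact: cH|exact: continuous_norm_powR].
apply: (@density_identity R mu (pi *+ 2) (fun t => H t `^ (1 - p)) (fun t => 2 * f t)) => //.
- by move=> t; exact: powR_ge0.
- by move=> t; rewrite mulr_ge0.
- by apply: measurable_funM => //; exact: measurable_cst.
- exact: f2_integrable f_ge0 f_meas f_int_fin.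
move=> psi cpsi psi2.
have cpG : continuous (fun t => psi t * H t `^ (1 - p)) by move=> t; apply: cvgM; [exact: cpsi|exact: cG].
have pG2 : psi (pi *+ 2) * H (pi *+ 2) `^ (1 - p) = psi 0 * H 0 `^ (1 - p).
  by rewrite psi2 -[in LHS](add0r (pi *+ 2)) Hper.
have L : \sum_(k < (m n).*2) edge (m n) (h n) k%:Z * (psi (k%:R * (pi / (m n)%:R)) *
    H (k%:R * (pi / (m n)%:R)) `^ (1 - p)) @[n --> U] --> f_moment f psi.
  by apply: (moment_limit p_gt0 p_lt1 m4 m_oo hP h_vertex hF oU HE cpsi).
exact: (cvg_unique _ (muE _ cpG pG2) L).
Qed.
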